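(* Assume the global noise law, the edge condition, and the real subspace local law (all defined in the context), and weighted compatibility on a neighborhood of a fixed $z_0>b$. Set $\vartheta_0=d(z_0)^{-1/2}$. If, for some fixed $\gamma>0$, $\min_{1\le i\le r_n}|\theta_{n,i}-\vartheta_0|\ge\gamma$ with probability tending to one, then $$\#\{j:\sigma_j(W_n)>z_0\}=\#\{i:\theta_{n,i}>\vartheta_0\}$$ with probability tending to one. No rank restriction and no upper bound on the spike strengths are needed. Consequently, if $B\subset(b,\infty)$ is a fixed finite union of intervals with finite endpoints in $(b,\infty)$, each endpoint $z$ of which satisfies the same hypotheses (weighted compatibility near $z$, and $\min_i|\theta_{n,i}-d(z)^{-1/2}|\ge\gamma$ with probability tending to one for some fixed $\gamma>0$), then $\#\{j:\sigma_j(W_n)\in B\}=\#\{i:\rho(\theta_{n,i})\in B\}$ with probability tending to one.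
   Context: Setting. $\mathbb F\in\{\mathbb R,\mathbb C\}$; for each $n$, $m=m(n)\ge n$ is an integer and $n/m\to c\in(0,1]$. $X_n$ is a random $n\times m$ matrix over $\mathbb F$; $P_n$ is an $n\times m$ matrix of rank $r_n$ (deterministic, or random on the same probability space; independence from $X_n$ is not assumed); $W_n=X_n+P_n$ with singular values $\sigma_1(W_n)\ge\dots\ge\sigma_n(W_n)$. With $\mathrm{St}(N,r)=\{Q\in\mathbb F^{N\times r}:Q^*Q=I_r\}$, fix $P_n=U_n\Theta_nV_n^*$, $U_n\in\mathrm{St}(n,r_n)$, $V_n\in\mathrm{St}(m,r_n)$, $\Theta_n=\operatorname{diag}(\theta_{n,1},\dots,\theta_{n,r_n})$, $\theta_{n,1}\ge\dots\ge\theta_{n,r_n}>0$. Global noise law. There is a compactly supported probability measure $\mu$ on $[0,\infty)$ such that the empirical spectral measure of $X_nX_n^*$ converges weakly to $\mu$ in probability and $\|X_n\|_{\mathrm{op}}\to b:=\sqrt{\sup\operatorname{supp}\mu}$ in probability. Transforms. For $\zeta\in\mathbb C\setminus[-b,b]$: $\phi(\zeta)=\int\frac{\zeta}{\zeta^2-x}\,\mu(dx)$, $\widetilde\phi(\zeta)=c\,\phi(\zeta)+\frac{1-c}{\zeta}$, $d(\zeta)=\phi(\zeta)\widetilde\phi(\zeta)$ (positive, strictly decreasing on $(b,\infty)$). Edge condition. $d(b+):=\lim_{z\downarrow b}d(z)\in(0,\infty)$. Put $\theta_\star=d(b+)^{-1/2}$; $\rho(\theta)=d^{-1}(\theta^{-2})\in(b,\infty)$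 for $\theta>\theta_\star$ and $\rho(\theta)=b$ for $0\le\theta\le\theta_\star$. Linearization. $\mathcal X_n=\begin{pmatrix}0&X_n\\ X_n^*&0\end{pmatrix}$, $\mathcal E_n=\begin{pmatrix}U_n&0\\0&V_n\end{pmatrix}$, $\mathcal K_n=\begin{pmatrix}0&\Theta_n\\\Theta_n&0\end{pmatrix}$, $\mathcal G_n(\zeta)=\mathcal E_n^*(\zeta I-\mathcal X_n)^{-1}\mathcal E_n$, $\mathcal M(\zeta)=\begin{pmatrix}\phi(\zeta)I_{r_n}&0\\0&\widetilde\phi(\zeta)I_{r_n}\end{pmatrix}$. Real subspace local law. For every compact interval $I\subset(b,\infty)$ there is a deterministic sequence $\varepsilon_n(I)\to0$ such that $\mathbb P\big(\|X_n\|_{\mathrm{op}}<\inf I,\ \sup_{z\in I}\|\mathcal G_n(z)-\mathcal M(z)\|_{\mathrm{op}}\le\varepsilon_n(I)\big)\to1$. Weighted compatibility on a neighborhood of $z\in(b,\infty)$: for some compact interval $I\subset(b,\infty)$ containing $z$ in its interior, $\sup_{x\in I}\big(\|(\mathcal G_n(x)-\mathcal M(x))\mathcal K_n\|_{\mathrm{op}}+\|\mathcal K_n(\mathcal G_n(x)-\mathcal M(x))\|_{\mathrm{op}}\big)\to0$ in probability (the supremum being $+\infty$ if $\mathcal G_n$ is undefined somewhere on $I$). *)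

(* Defs.v *)
From HB Require Import structures.
From mathcomp Require Import all_boot all_order all_algebra spectral complex.
From mathcomp Require Import all_classical all_reals all_analysis.

Set Implicit Arguments.
Unset Strict Implicit.
Unset Printing Implicit Defensive.

Import Order.TTheory GRing.Theory Num.Theory.
Import numFieldNormedType.Exports.

Export Order.TTheory GRing.Theory Num.Theory.
Export numFieldNormedType.Exports.

#[export] Set Implicit Arguments.

Local Open Scope classical_set_scope.
Local Open Scope complex_scope.
Local Open Scope ring_scope.
Local Open Scope sesquilinear_scope.

(* The base field is the reals or the complex numbers. All matrices have entries
   in R[i]; those over the reals are the ones whose entries have imaginary part
   zero. *)
Inductive base_field := BaseReal | BaseComplex.

Definition scalars (R : realType) (F : base_field) : {pred R[i]} :=
  fun z => if F is BaseReal then complex.Im z == 0 else true.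

(* As A *m A^t* is Hermitian its spectral_diag is the list, with multiplicity,
   of its real eigenvalues. *)
Definition gram_eigenvalue (R : realType) (n m : nat) (A : 'M[R[i]]_(n, m))
    (j : nat) : R :=
  nth 0 (sort (fun x y : R => y <= x)
           [seq complex.Re (spectral_diag (A *m A^t*) 0 i) | i <- enum 'I_n]) j.

(* singular_value A 0 >= ... >= singular_value A n.-1 (used for n <= m) *)
Definition singular_value (R : realType) (n m : nat) (A : 'M[R[i]]_(n, m))
    (j : nat) : R :=
  Num.sqrt (gram_eigenvalue A j).

(* empirical spectral measure of A *m A^t* *)
Definition esd (R : realType) (n m : nat) (A : 'M[R[i]]_(n, m)) :
    {measure set (measurableTypeR R) -> \bar R} :=
  mscale ((n%:R : R)^-1)%:nng
    (msum (fun j => \d_(gram_eigenvalue A j : measurableTypeR R)) n).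

Definition norm2 (R : realType) (n : nat) (v : 'cV[R[i]]_n) : R :=
  Num.sqrt (\sum_(i < n) complex.Re `|v i 0| ^+ 2).

Definition opnorm (R : realType) (n m : nat) (A : 'M[R[i]]_(n, m)) : R :=
  sup [set norm2 (A *m v) | v in [set v : 'cV[R[i]]_m | norm2 v <= 1]].

Definition stiefel (R : realType) (F : base_field) (N r : nat) :
    set 'M[R[i]]_(N, r) :=
  [set Q | Q \is a mxOver (scalars F) /\ Q^t* *m Q = 1%:M].

Definition theta_mx (R : realType) (r : nat) (theta : 'I_r -> R) :
    'M[R[i]]_r := diag_mx (\row_i (theta i)%:C).

(* Probability tending to one along a sequence of probability spaces, for
   possibly non-measurable events: the n-th event contains a measurable one whose
   probability tends to 1. For measurable events see whp_measurable. *)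
Definition whp (R : realType) (d : nat -> measure_display)
    (T : forall n, measurableType (d n)) (Pr : forall n, probability (T n) R)
    (A : forall n, set (T n)) : Prop :=
  exists E : forall n, set (T n),
    [/\ forall n, measurable (E n), forall n, E n `<=` A n
      & Pr n (E n) @[n --> \oo] --> 1%E].

Lemma whp_measurable (R : realType) (d : nat -> measure_display)
    (T : forall n, measurableType (d n)) (Pr : forall n, probability (T n) R)
    (A : forall n, set (T n)) : (forall n, measurable (A n)) ->
  whp Pr A <-> Pr n (A n) @[n --> \oo] --> 1%E.
Proof.
move=> mA; split=> [[E [mE EA cE]]|cA]; last first.
  by exists A; split => // n x Ax.
apply: (squeeze_cvge _ cE (cvg_cst 1%E)).
apply: nearW => n; apply/andP; split; last exact: probability_le1.
by apply: le_measure; rewrite ?inE; [exact: mE|exact: mA|exact: EA].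
Qed.

Definition cvg_in_prob (R : realType) (d : nat -> measure_display)
    (T : forall n, measurableType (d n)) (Pr : forall n, probability (T n) R)
    (Y : forall n, T n -> \bar R) (y : R) : Prop :=
  forall e : R, 0 < e ->
    whp Pr (fun n => [set w | (`|Y n w - y%:E| < e%:E)%E]).

Definition random_mx (R : realType) (d : measure_display)
    (T : measurableType d) (n m : nat) (A : T -> 'M[R[i]]_(n, m)) : Prop :=
  forall i j,
    measurable_fun setT (fun w => complex.Re (A w i j) : measurableTypeR R) /\
    measurable_fun setT (fun w => complex.Im (A w i j) : measurableTypeR R).

Definition supp (R : realType) (mu : set R -> \bar R) : set R :=
  [set x | forall e : R, 0 < e -> (0 < mu (ball x e))%E].

Definition edge (R : realType) (mu : set R -> \bar R) : R :=
  Num.sqrt (sup (supp mu)).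

Definition global_noise_law (R : realType) (m : nat -> nat)
    (d : nat -> measure_display) (T : forall n, measurableType (d n))
    (Pr : forall n, probability (T n) R)
    (X : forall n, T n -> 'M[R[i]]_(n, m n))
    (mu : probability (measurableTypeR R) R) : Prop :=
  [/\ mu `[0, +oo[%classic = 1%E, compact (supp mu),
      forall f : R -> R, continuous f -> bounded_fun f ->
        cvg_in_prob Pr (fun n w => (\int[esd (X n w)]_x (f x)%:E)%E)
          (Rintegral mu setT f)
    & cvg_in_prob Pr (fun n w => (opnorm (X n w))%:E) (edge mu)].

(* The transforms, at real arguments z > edge mu, the only ones that matter
   for the statement. *)
Definition phi (R : realType) (mu : probability (measurableTypeR R) R)
    (z : R) : R := Rintegral mu setT (fun x => z / (z ^+ 2 - x)).

Definition phit (R : realType) (mu : probability (measurableTypeR R) R)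
    (c z : R) : R := c * phi mu z + (1 - c) / z.

Definition dtr (R : realType) (mu : probability (measurableTypeR R) R)
    (c z : R) : R := phi mu z * phit mu c z.

Definition dedge (R : realType) (mu : probability (measurableTypeR R) R)
    (c : R) : R := lim (dtr mu c z @[z --> (edge mu)^'+]).

Definition edge_condition (R : realType)
    (mu : probability (measurableTypeR R) R) (c : R) : Prop :=
  cvg (dtr mu c z @[z --> (edge mu)^'+]) /\ 0 < dedge mu c.

Definition theta_star (R : realType)
    (mu : probability (measurableTypeR R) R) (c : R) : R :=
  (Num.sqrt (dedge mu c))^-1.

Definition rho (R : realType) (mu : probability (measurableTypeR R) R)
    (c theta : R) : R :=
  if theta_star mu c < theta
  then xget (edge mu) [set z | edge mu < z /\ dtr mu c z = theta ^- 2]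
  else edge mu.

Definition spike_loc (R : realType) (mu : probability (measurableTypeR R) R)
    (c z : R) : R := (Num.sqrt (dtr mu c z))^-1.

Definition linX (R : realType) (n m : nat) (X : 'M[R[i]]_(n, m)) :
    'M[R[i]]_(n + m) := block_mx 0 X (X^t*) 0.

Definition frameE (R : realType) (n m r : nat) (U : 'M[R[i]]_(n, r))
    (V : 'M[R[i]]_(m, r)) : 'M[R[i]]_(n + m, r + r) := block_mx U 0 0 V.

Definition spikeK (R : realType) (r : nat) (theta : 'I_r -> R) :
    'M[R[i]]_(r + r) := block_mx 0 (theta_mx theta) (theta_mx theta) 0.

Definition resolvent_defined (R : realType) (n m : nat)
    (X : 'M[R[i]]_(n, m)) (z : R[i]) : bool := z%:M - linX X \in unitmx.

Definition compG (R : realType) (n m r : nat) (X : 'M[R[i]]_(n, m))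
    (U : 'M[R[i]]_(n, r)) (V : 'M[R[i]]_(m, r)) (z : R[i]) :
    'M[R[i]]_(r + r) :=
  (frameE U V)^t* *m invmx (z%:M - linX X) *m frameE U V.

Definition limM (R : realType) (mu : probability (measurableTypeR R) R)
    (c : R) (r : nat) (z : R) : 'M[R[i]]_(r + r) :=
  block_mx (phi mu z)%:C%:M 0 0 (phit mu c z)%:C%:M.

(* || G(z) - M(z) ||, and +oo where G is undefined *)
Definition law_error (R : realType) (mu : probability (measurableTypeR R) R)
    (c : R) (n m r : nat) (X : 'M[R[i]]_(n, m)) (U : 'M[R[i]]_(n, r))
    (V : 'M[R[i]]_(m, r)) (z : R) : \bar R :=
  if resolvent_defined X z%:C
  then (opnorm (compG X U V z%:C - limM mu c r z))%:E else +oo%E.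

(* || (G(z) - M(z)) K || + || K (G(z) - M(z)) ||, and +oo where G is
   undefined *)
Definition weighted_error (R : realType)
    (mu : probability (measurableTypeR R) R) (c : R) (n m r : nat)
    (X : 'M[R[i]]_(n, m)) (U : 'M[R[i]]_(n, r)) (V : 'M[R[i]]_(m, r))
    (theta : 'I_r -> R) (z : R) : \bar R :=
  if resolvent_defined X z%:C
  then (opnorm ((compG X U V z%:C - limM mu c r z) *m spikeK theta)
        + opnorm (spikeK theta *m (compG X U V z%:C - limM mu c r z)))%:E
  else +oo%E.

Definition local_law (R : realType) (m : nat -> nat)
    (d : nat -> measure_display) (T : forall n, measurableType (d n))
    (Pr : forall n, probability (T n) R)
    (X : forall n, T n -> 'M[R[i]]_(n, m n)) (r : forall n, T n -> nat)
    (U : forall n (w : T n), 'M[R[i]]_(n, r n w))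
    (V : forall n (w : T n), 'M[R[i]]_(m n, r n w))
    (mu : probability (measurableTypeR R) R) (c : R) : Prop :=
  forall al be : R, edge mu < al -> al <= be ->
    exists eps : nat -> R, eps n @[n --> \oo] --> (0 : R) /\
      whp Pr (fun n => [set w | opnorm (X n w) < al /\
        (ereal_sup [set law_error mu c (X n w) (U n w) (V n w) z
                   | z in `[al, be]%classic] <= (eps n)%:E)%E]).

Definition weighted_compat (R : realType) (m : nat -> nat)
    (d : nat -> measure_display) (T : forall n, measurableType (d n))
    (Pr : forall n, probability (T n) R)
    (X : forall n, T n -> 'M[R[i]]_(n, m n)) (r : forall n, T n -> nat)
    (U : forall n (w : T n), 'M[R[i]]_(n, r n w))
    (V : forall n (w : T n), 'M[R[i]]_(m n, r n w))
    (theta : forall n (w : T n), 'I_(r n w) -> R)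
    (mu : probability (measurableTypeR R) R) (c z : R) : Prop :=
  exists al be : R, [/\ edge mu < al, al < z, z < be
    & cvg_in_prob Pr (fun n w => ereal_sup
        [set weighted_error mu c (X n w) (U n w) (V n w) (@theta n w) x
        | x in `[al, be]%classic]) 0].

Definition spikes_avoid (R : realType)
    (d : nat -> measure_display) (T : forall n, measurableType (d n))
    (Pr : forall n, probability (T n) R) (r : forall n, T n -> nat)
    (theta : forall n (w : T n), 'I_(r n w) -> R) (t : R) : Prop :=
  exists2 gamma : R, 0 < gamma &
    whp Pr (fun n => [set w | forall i, gamma <= `|theta n w i - t|]).

(* Main.v *)
Require Import Defs.
From HB Require Import structures.
From mathcomp Require Import all_boot all_order all_algebra spectral complex.
From mathcomp Require Import all_classical all_reals all_analysis.
From mathcomp Require Import measurable_realfun.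
From mathcomp Require Import ring lra zify.

(** The claim is an inertia count. Fix z above the edge and write A for
    z - linX X, which is positive definite once X has norm below z, E for the
    frame of U and V, D for the diagonal matrix with the square roots of the
    spikes on both diagonal blocks, J for the swap of these two blocks, so that
    K = D J D, and G = E^* A^-1 E. The bordered matrix [[A, E D], [D E^*, J]]
    can be reduced in two ways. Eliminating A leaves A and J - D G D; eliminating
    J leaves A - E K E^* = z - linX W and J. Since A is positive, J has signature
    (r, r), and z - linX W reduces further to z - W W^* / z and a positive block,
    the number of singular values of W above z is the number of negative squares
    of J - D G D minus r (spike_count).

    If G is replaced by M, then J - D M D splits into the 2 x 2 forms
    [[- phi theta, 1], [1, - phit theta]]. One congruence, the same for all theta,
    diagonalizes them simultaneously, with diagonal entries
    2 d (t - theta) and - 2 d (t + theta), where d = phi phit and t = d^(-1/2)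
    (model_congr). So there are r negative entries, plus one for each spike above
    t, and all entries stay at distance at least 2 d min(gamma, t) from zero, no
    matter how many or how large the spikes are. The actual error D (G - M) D is
    Hermitian, and its eigenvalues are among those of D^2 (G - M); hence it is
    bounded by the weighted error K (G - M) (symmetrized_bound), and a small
    weighted error does not change the signature. The perturbed matrix being
    nondegenerate, no singular value of W equals z either.

    For the unions of intervals, d is continuous, strictly decreasing and tends
    to zero above the edge, so rho(theta) lies above z exactly when theta lies
    above the critical strength at z (rho_gt, rho_lt). With probability tending to
    one the families of singular values and of predicted locations therefore
    avoid all endpoints and have equally many members above each of them.
    Off the endpoints, the indicator of the union is an integer combination of
    indicators of half-lines starting at endpoints, so the counts in the union
    agree (card_union_intervals). *)

Unset Strict Implicit.
Unset Printing Implicit Defensive.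

Local Open Scope classical_set_scope.
Local Open Scope complex_scope.
Local Open Scope ring_scope.
Local Open Scope sesquilinear_scope.

(** * Adjoints of complex matrices *)

Section Adjoint.
Variable R : realType.
Local Notation C := R[i].

Lemma adjmxM m n p (A : 'M[C]_(m, n)) (B : 'M[C]_(n, p)) :
  (A *m B)^t* = B^t* *m A^t*.
Proof. by rewrite trmx_mul map_mxM. Qed.

Lemma adjmxD m n (A B : 'M[C]_(m, n)) : (A + B)^t* = A^t* + B^t*.
Proof. by rewrite linearD map_mxD. Qed.

Lemma adjmxN m n (A : 'M[C]_(m, n)) : (- A)^t* = - A^t*.
Proof. by rewrite linearN map_mxN. Qed.

Lemma adjmx0 m n : (0 : 'M[C]_(m, n))^t* = 0.
Proof. by rewrite trmx0 map_mx0. Qed.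

Lemma adjmx_scale m n (a : R) (A : 'M[C]_(m, n)) :
  (a%:C *: A)^t* = a%:C *: A^t*.
Proof. by apply/matrixP => i j; rewrite !mxE rmorphM /= -[_^*]/(_^*%C) conjc_real. Qed.

Lemma adjmx_scalar n (a : R) : (a%:C%:M : 'M[C]_n)^t* = a%:C%:M.
Proof. by rewrite tr_scalar_mx map_scalar_mx /= -[_^*]/(_^*%C) conjc_real. Qed.

Lemma adjmx1 n : (1%:M : 'M[C]_n)^t* = 1%:M.
Proof. exact: (@adjmx_scalar n 1). Qed.

Lemma adjmx_rdiag n (l : 'I_n -> R) :
  (diag_mx (\row_i (l i)%:C) : 'M[C]_n)^t* = diag_mx (\row_i (l i)%:C).
Proof.
apply/matrixP => i j; rewrite !mxE rmorphMn /= -[_^*]/(_^*%C) conjc_real eq_sym.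
by case: eqP => [->|].
Qed.

Lemma adjmx_block m1 m2 n1 n2 (A : 'M[C]_(m1, n1)) (B : 'M[C]_(m1, n2))
    (D : 'M[C]_(m2, n1)) (E : 'M[C]_(m2, n2)) :
  (block_mx A B D E)^t* = block_mx (A^t*) (D^t*) (B^t*) (E^t*).
Proof. by rewrite tr_block_mx map_block_mx. Qed.

Lemma adjmx_col m1 m2 n (A : 'M[C]_(m1, n)) (B : 'M[C]_(m2, n)) :
  (col_mx A B)^t* = row_mx (A^t*) (B^t*).
Proof. by rewrite tr_col_mx map_row_mx. Qed.

End Adjoint.

(** * Hermitian forms and subspaces of constant sign *)

Section Forms.
Variable R : realType.
Local Notation C := R[i].

Lemma ReD (x y : C) : Re (x + y) = Re x + Re y.
Proof. by case: x y => [? ?] []. Qed.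
Lemma ReN (x : C) : Re (- x) = - Re x.
Proof. by case: x. Qed.
Lemma ReZ (a : R) (x : C) : Re (a%:C * x) = a * Re x.
Proof. by case: x => x y /=; rewrite mul0r subr0. Qed.

Lemma Re_sum I (s : seq I) (p : pred I) (F : I -> C) :
  Re (\sum_(i <- s | p i) F i) = \sum_(i <- s | p i) Re (F i).
Proof. exact: (big_morph (@Re R) ReD erefl). Qed.

Definition sqmod (z : C) : R := Re z ^+ 2 + Im z ^+ 2.

Lemma sqmod_ge0 z : 0 <= sqmod z.
Proof. by rewrite addr_ge0 ?sqr_ge0. Qed.

Lemma sqmod_gt0 z : z != 0 -> 0 < sqmod z.
Proof.
move=> z0; rewrite lt_neqAle sqmod_ge0 andbT eq_sym paddr_eq0 ?sqr_ge0//.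
by rewrite !sqrf_eq0; move: z0; rewrite eq_complex.
Qed.

Lemma normc_sqmod (x : C) : Re `|x| = Num.sqrt (sqmod x).
Proof. by rewrite normc_def. Qed.

Definition hform N (H : 'M[C]_N) (v : 'cV[C]_N) : R :=
  Re ((v^t* *m H *m v) 0 0).

Lemma hformD N (H K : 'M[C]_N) v : hform (H + K) v = hform H v + hform K v.
Proof. by rewrite /hform mulmxDr mulmxDl mxE ReD. Qed.

Lemma hformN N (H : 'M[C]_N) v : hform (- H) v = - hform H v.
Proof. by rewrite /hform mulmxN mulNmx mxE ReN. Qed.

Lemma hformB N (H K : 'M[C]_N) v : hform (H - K) v = hform H v - hform K v.
Proof. by rewrite hformD hformN. Qed.

Lemma hformZ N (a : R) (H : 'M[C]_N) v : hform (a%:C *: H) v = a * hform H v.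
Proof. by rewrite /hform -scalemxAr -scalemxAl mxE ReZ. Qed.

Lemma hform_congr N k (H : 'M[C]_N) (L : 'M[C]_(N, k)) v :
  hform (L^t* *m H *m L) v = hform H (L *m v).
Proof. by rewrite /hform adjmxM !mulmxA. Qed.

Lemma hform_diag N (D : 'rV[C]_N) v :
  hform (diag_mx D) v = \sum_i Re (D 0 i) * sqmod (v i 0).
Proof.
rewrite /hform -mulmxA mxE Re_sum; apply: eq_bigr => i _.
rewrite mul_diag_mx !mxE -[_^*]/(_^*%C).
rewrite /sqmod; case: (v i 0) (D 0 i) => a b [x y] /=; ring.
Qed.

Lemma norm2_sqr N (v : 'cV[C]_N) : norm2 v ^+ 2 = \sum_i sqmod (v i 0).
Proof.
rewrite /norm2 sqr_sqrtr; last by apply: sumr_ge0 => i _; rewrite sqr_ge0.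
by apply: eq_bigr => i _; rewrite normc_sqmod sqr_sqrtr// sqmod_ge0.
Qed.

Lemma norm2_ge0 N (v : 'cV[C]_N) : 0 <= norm2 v.
Proof. exact: sqrtr_ge0. Qed.

Lemma norm2_gt0 N (v : 'cV[C]_N) : v != 0 -> 0 < norm2 v.
Proof.
move=> v0; rewrite lt_neqAle norm2_ge0 andbT eq_sym -sqrf_eq0 norm2_sqr.
apply: contra v0; rewrite psumr_eq0; last by move=> ? _; exact: sqmod_ge0.
move/allP => h; apply/eqP/colP => i; rewrite mxE; apply/eqP.
have := h i (mem_index_enum i) => /=; apply: contraTT => /sqmod_gt0.
by case: ltgtP.
Qed.

Lemma hform_scalar N (a : R) (v : 'cV[C]_N) :
  hform a%:C%:M v = a * norm2 v ^+ 2.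
Proof.
by rewrite -diag_const_mx hform_diag norm2_sqr mulr_sumr; apply: eq_bigr => i _; rewrite mxE.
Qed.

Lemma hform_gram N k (B : 'M[C]_(k, N)) v :
  hform (B^t* *m B) v = norm2 (B *m v) ^+ 2.
Proof.
rewrite -[B^t*]mulmx1 hform_congr; have := @hform_scalar _ 1 (B *m v).
by rewrite mul1r.
Qed.

Lemma hform_block N1 N2 (A : 'M[C]_N1) (B : 'M[C]_N2) x y :
  hform (block_mx A 0 0 B) (col_mx x y) = hform A x + hform B y.
Proof.
rewrite /hform adjmx_col mul_row_block mul_row_col !mulmx0 addr0 add0r.
by rewrite mxE ReD.
Qed.

Lemma norm2_col N1 N2 (x : 'cV[C]_N1) (y : 'cV[C]_N2) :
  norm2 (col_mx x y) ^+ 2 = norm2 x ^+ 2 + norm2 y ^+ 2.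
Proof.
rewrite !norm2_sqr big_split_ord /=; congr (_ + _); apply: eq_bigr => i _.
  by rewrite col_mxEu.
by rewrite col_mxEd.
Qed.

Lemma hform0 N (H : 'M[C]_N) : hform H 0 = 0.
Proof. by rewrite /hform mulmx0 mxE. Qed.

(** Closure under sums and positive scaling makes a sign condition survive
    orthogonal sums and diagonalization; the four conditions used are the two
    strict and the two large signs. *)
Definition cone (P : pred R) : Prop :=
  (forall a b, P a -> P b -> P (a + b)) /\ (forall t a, 0 < t -> P a -> P (t * a)).

Lemma cone_lt : cone (fun x => x < 0).
Proof. by split=> [a b|t a] ? ?; [lra|rewrite pmulr_rlt0]. Qed.
Lemma cone_gt : cone (fun x => 0 < x).
Proof. by split=> [a b|t a] ? ?; [lra|rewrite mulr_gt0]. Qed.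
Lemma cone_le : cone (fun x => x <= 0).
Proof. by split=> [a b|t a] ? ?; [lra|rewrite pmulr_rle0]. Qed.
Lemma cone_ge : cone (fun x => 0 <= x).
Proof. by split=> [a b|t a] ? ?; [lra|rewrite pmulr_rge0]. Qed.

(** Inertia is handled through subspaces of constant sign: a lower bound on
    the number of eigenvalues of a given sign is a parametrized subspace of that
    dimension, and an upper bound comes from a subspace of the opposite sign.
    This survives congruence and perturbation without any continuity of
    eigenvalues. *)
Definition form_dim (P : pred R) N (H : 'M[C]_N) (k : nat) : Prop :=
  exists S : 'M[C]_(N, k), forall x, x != 0 -> S *m x != 0 /\ P (hform H (S *m x)).

Lemma form_dim0 P N (H : 'M[C]_N) : form_dim P H 0.
Proof. by exists 0 => x; rewrite (flatmx0 x) eqxx. Qed.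

Lemma form_dim_full (P : pred R) N (H : 'M[C]_N) :
  (forall v, v != 0 -> P (hform H v)) -> form_dim P H N.
Proof. by move=> h; exists 1%:M => x x0; rewrite mul1mx; split=> //; exact: h. Qed.

Lemma kernel_free_leq N k (S : 'M[C]_(N, k)) :
  (forall x : 'cV_k, S *m x = 0 -> x = 0) -> (k <= N)%N.
Proof.
move=> h; have: row_free S^T.
  apply/inj_row_free => v /(congr1 trmx); rewrite trmx_mul trmxK trmx0 => /h.
  by move/(congr1 trmx); rewrite trmxK trmx0.
by rewrite -row_leq_rank => /leq_trans; apply; rewrite rank_leq_col.
Qed.

(** Subspaces on which the form has incompatible signs meet only at the
    origin, so their dimensions add up to at most that of the whole space. *)
Lemma form_dim_disjoint (P Q : pred R) N (H : 'M[C]_N) k l :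
  (forall x, P x -> Q x -> False) ->
  form_dim P H k -> form_dim Q H l -> (k + l <= N)%N.
Proof.
move=> dPQ [S hS] [S' hS']; apply: (@kernel_free_leq _ _ (row_mx S S')) => x.
rewrite -[x]vsubmxK mul_row_col.
set a := usubmx x; set b := dsubmx x => /eqP; rewrite addr_eq0 => /eqP Sab.
have [a0|a0] := eqVneq a 0; have [b0|b0] := eqVneq b 0.
- by rewrite a0 b0 col_mx0.
- by have [] := hS' _ b0; rewrite -oppr_eq0 -Sab a0 mulmx0 eqxx.
- by have [] := hS _ a0; rewrite Sab b0 mulmx0 oppr0 eqxx.
- have [_ Pa] := hS _ a0; have [_ Qb] := hS' _ b0.
  case: (dPQ _ _ Qb); move: Pa; rewrite Sab /hform adjmxN !(mulNmx, mulmxN) opprK.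
  by [].
Qed.

Lemma form_dim_congr (P : pred R) N (H : 'M[C]_N) (L : 'M[C]_N) k :
  L \in unitmx -> form_dim P (L^t* *m H *m L) k <-> form_dim P H k.
Proof.
move=> uL; split=> -[S hS]; [exists (L *m S)|exists (invmx L *m S)] => x x0.
  have [s0 hp] := hS _ x0; split; last by rewrite -mulmxA -hform_congr.
  apply: contra s0 => /eqP; rewrite -mulmxA => /(congr1 (mulmx (invmx L))).
  by rewrite mulKmx// mulmx0 => ->.
have [s0 hp] := hS _ x0; split; last by rewrite hform_congr -mulmxA mulKVmx.
by apply: contra s0 => /eqP; rewrite -mulmxA => /(congr1 (mulmx L)); rewrite mulKVmx// mulmx0 => ->.
Qed.

Lemma form_dim_block (P : pred R) N1 N2 (A : 'M[C]_N1) (B : 'M[C]_N2) k l :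
  cone P -> form_dim P A k -> form_dim P B l ->
  form_dim P (block_mx A 0 0 B) (k + l).
Proof.
move=> [Padd _] [S hS] [S' hS']; exists (block_mx S 0 0 S') => x.
rewrite -[x]vsubmxK mul_block_col !mul0mx addr0 add0r col_mx_eq0 col_mx_eq0.
rewrite hform_block; set a := usubmx x; set b := dsubmx x.
have [->|a0] := eqVneq a 0; have [->|b0] := eqVneq b 0 => //= _.
- by have [s0 Pb] := hS' _ b0; rewrite mulmx0 eqxx hform0 add0r.
- by have [s0 Pb] := hS _ a0; rewrite !mulmx0 (negPf s0) hform0 addr0.
- have [s0 Pa] := hS _ a0; have [s0' Pb] := hS' _ b0.
  by rewrite (negPf s0) (negPf s0'); split=> //; exact: Padd.
Qed.

(** The coordinate subspace spanned by the indices whose diagonal entry has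
    the required sign. The entries may be complex because the form only sees their real
    parts; this is how spectral diagonals enter. *)
Lemma form_dim_diag (P : pred R) N (D : 'rV[C]_N) :
  cone P -> form_dim P (diag_mx D) #|[set i | P (Re (D 0 i))]%SET|.
Proof.
move=> [Padd Pscale]; set A := [set i | _]%SET.
exists (\matrix_(i, j) (i == enum_val j)%:R) => x x0.
set v := _ *m x.
have vA j : v (enum_val j) 0 = x j 0.
  rewrite /v mxE (bigD1 j)//= big1 ?addr0 => [|k kj].
    by rewrite mxE eqxx mul1r.
  by rewrite mxE (inj_eq enum_val_inj) eq_sym (negPf kj) mul0r.
have vNA i : i \notin A -> v i 0 = 0.
  move=> iA; rewrite /v mxE big1// => k _; rewrite mxE.
  by case: eqP iA => [->|_ _]; rewrite ?enum_valP ?mul0r.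
have [j xj] : exists j, x j 0 != 0.
  apply/existsP; apply: contraNT x0; rewrite negb_exists => /forallP h.
  by apply/eqP/colP => j; rewrite mxE; apply/eqP; have := h j; rewrite negbK.
split.
  by apply: contra xj => /eqP v0; rewrite -vA v0 mxE.
rewrite hform_diag.
pose P' (y : R) := (y == 0) || P y.
rewrite (bigD1 (enum_val j))//= vA.
have h1 : P (Re (D 0 (enum_val j)) * sqmod (x j 0)).
  rewrite mulrC; apply: Pscale; first exact: sqmod_gt0.
  by have := enum_valP j; rewrite inE.
apply: (big_ind (fun y => forall z, P z -> P (z + y))) => //.
- by move=> z; rewrite addr0.
- by move=> y y' hy hy' z Pz; rewrite addrA; apply: hy'; apply: hy.
move=> i _ z Pz; have [iA|/vNA ->] := boolP (i \in A); last first.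
  by rewrite /sqmod /= expr0n /= addr0 mulr0 addr0.
have [->|vi] := eqVneq (v i 0) 0.
  by rewrite /sqmod /= expr0n /= addr0 mulr0 addr0.
apply: Padd => //; rewrite mulrC; apply: Pscale; first exact: sqmod_gt0.
by move: iA; rewrite inE.
Qed.

Lemma form_dim_mono (P : pred R) N (H K : 'M[C]_N) k :
  (forall v, P (hform H v) -> P (hform K v)) -> form_dim P H k -> form_dim P K k.
Proof. by move=> h [S hS]; exists S => x /hS[? /h]. Qed.

(** * Schur complements and the spectral theorem *)

(** With the off-diagonal block written as A Z, the congruence is a polynomial
    identity; for invertible A every block has this shape. *)
Lemma schur_ul N1 N2 (A : 'M[C]_N1) (B : 'M[C]_N2) (Z : 'M[C]_(N1, N2)) :
  let L := block_mx 1%:M Z 0 1%:M in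
  A^t* = A ->
  block_mx A (A *m Z) ((A *m Z)^t*) B =
  L^t* *m block_mx A 0 0 (B - Z^t* *m A *m Z) *m L.
Proof.
move=> L hA; rewrite /L adjmx_block !adjmx1 adjmx0 !mulmx_block.
rewrite !(mul0mx, mulmx0, mul1mx, mulmx1, addr0, add0r) adjmxM hA.
by rewrite addrC subrK.
Qed.

Lemma schur_dr N1 N2 (A : 'M[C]_N1) (B : 'M[C]_N2) (Z : 'M[C]_(N2, N1)) :
  let L := block_mx 1%:M 0 Z 1%:M in
  B^t* = B ->
  block_mx A ((B *m Z)^t*) (B *m Z) B =
  L^t* *m block_mx (A - Z^t* *m B *m Z) 0 0 B *m L.
Proof.
move=> L hB; rewrite /L adjmx_block !adjmx1 adjmx0 !mulmx_block.
rewrite !(mul0mx, mulmx0, mul1mx, mulmx1, addr0, add0r) adjmxM hB.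
by rewrite subrK.
Qed.

Lemma form_dim_schur_ul (P : pred R) N1 N2 (A : 'M[C]_N1) (B : 'M[C]_N2)
    (Z : 'M[C]_(N1, N2)) k : A^t* = A ->
  form_dim P (block_mx A (A *m Z) ((A *m Z)^t*) B) k <->
  form_dim P (block_mx A 0 0 (B - Z^t* *m A *m Z)) k.
Proof.
move=> hA; rewrite (schur_ul _ _ hA); apply: form_dim_congr.
by rewrite unitmxE det_ublock !det1 mulr1 unitr1.
Qed.

Lemma form_dim_schur_dr (P : pred R) N1 N2 (A : 'M[C]_N1) (B : 'M[C]_N2)
    (Z : 'M[C]_(N2, N1)) k : B^t* = B ->
  form_dim P (block_mx A ((B *m Z)^t*) (B *m Z) B) k <->
  form_dim P (block_mx (A - Z^t* *m B *m Z) 0 0 B) k.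
Proof.
move=> hB; rewrite (schur_dr _ _ hB); apply: form_dim_congr.
by rewrite unitmxE det_lblock !det1 mulr1 unitr1.
Qed.

Lemma hermitian_spectral N (H : 'M[C]_N) : H^t* = H ->
  H = (spectralmx H)^t* *m diag_mx (spectral_diag H) *m spectralmx H.
Proof.
move=> hH; rewrite -invmx_unitary ?spectral_unitarymx//.
by apply/orthomx_spectralP/normalmxP; rewrite hH.
Qed.

(** * The operator norm *)

Lemma norm2_scale N (a : C) (v : 'cV[C]_N) : norm2 (a *: v) ^+ 2 = sqmod a * norm2 v ^+ 2.
Proof.
rewrite !norm2_sqr mulr_sumr; apply: eq_bigr => i _; rewrite mxE.
by rewrite /sqmod; case: a (v i 0) => [a b] [x y] /=; ring.
Qed.

Lemma norm2_scaler N (a : R) (v : 'cV[C]_N) : norm2 (a%:C *: v) = `|a| * norm2 v.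
Proof.
apply/eqP; rewrite -(@eqrXn2 _ 2)// ?norm2_ge0// ?mulr_ge0// ?norm2_ge0//.
by rewrite norm2_scale exprMn /sqmod /= expr0n /= addr0 real_normK// num_real.
Qed.

Lemma norm2_coord_le1 N (v : 'cV[C]_N) i : norm2 v <= 1 -> sqmod (v i 0) <= 1.
Proof.
move=> v1; apply: (@le_trans _ _ (norm2 v ^+ 2)); last by rewrite expr_le1// norm2_ge0.
rewrite norm2_sqr (bigD1 i)//= lerDl; apply: sumr_ge0 => j _; exact: sqmod_ge0.
Qed.

Lemma norm2_le_sqr N (v : 'cV[C]_N) (a : R) : 0 <= a -> norm2 v ^+ 2 <= a ^+ 2 -> norm2 v <= a.
Proof. by move=> a0; rewrite ler_pXn2r// nnegrE// norm2_ge0. Qed.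

Lemma sqmod_sum I (s : seq I) (p : pred I) (F : I -> C) :
  sqmod (\sum_(i <- s | p i) F i) <= (\sum_(i <- s | p i) Re `|F i|) ^+ 2.
Proof.
have s0 : 0 <= \sum_(i <- s | p i) Re `|F i|.
  by apply: sumr_ge0 => i _; rewrite normc_sqmod sqrtr_ge0.
rewrite -(@ler_sqrt R) ?sqr_ge0// sqrtr_sqr -normc_sqmod (ger0_norm s0).
by have := ler_norm_sum s F p; rewrite lecE Re_sum => /andP[].
Qed.

Lemma opnorm_has_ubound n m (A : 'M[C]_(n, m)) :
  has_ubound [set norm2 (A *m v) | v in [set v : 'cV[C]_m | norm2 v <= 1]].
Proof.
pose rowsum i := \sum_j Re `|A i j|.
have rowsum0 i : 0 <= rowsum i.
  by apply: sumr_ge0 => j _; rewrite normc_sqmod sqrtr_ge0.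
exists (Num.sqrt (\sum_i rowsum i ^+ 2)) => _ [v /= v1 <-].
apply: norm2_le_sqr; first exact: sqrtr_ge0.
rewrite norm2_sqr sqr_sqrtr; last by apply: sumr_ge0 => ? _; rewrite sqr_ge0.
apply: ler_sum => i _; rewrite mxE.
apply: (le_trans (sqmod_sum _ _ _)); rewrite ler_pXn2r ?nnegrE//.
  apply: ler_sum => j _; rewrite normrM.
  rewrite [_ * _]lock -[X in _ <= X]mulr1 -lock.
  have -> : Re (`|A i j| * `|v j 0|) = Re `|A i j| * Re `|v j 0|.
    by rewrite !normc_def /= mulr0 subr0.
  apply: ler_wpM2l; first by rewrite normc_sqmod sqrtr_ge0.
  by rewrite normc_sqmod -[leRHS]sqrtr1 ler_sqrt// norm2_coord_le1.
by apply: sumr_ge0 => j _; rewrite normc_sqmod sqrtr_ge0.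
Qed.

(** The supremum defining the operator norm runs over a bounded set because
    the matrix has finitely many entries; homogeneity does the rest. *)
Lemma opnormP n m (A : 'M[C]_(n, m)) v : norm2 (A *m v) <= opnorm A * norm2 v.
Proof.
have [->|v0] := eqVneq v 0.
  have z k : norm2 (0 : 'cV[C]_k) = 0.
    by apply/eqP; rewrite -sqrf_eq0 norm2_sqr big1// => i _; rewrite mxE /sqmod /= expr0n addr0.
  by rewrite mulmx0 !z mulr0.
have p := norm2_gt0 v0; rewrite -ler_pdivrMr// mulrC.
have -> : (norm2 v)^-1 * norm2 (A *m v) = norm2 (A *m ((norm2 v)^-1%:C *: v)).
  by rewrite -scalemxAr norm2_scaler ger0_norm// invr_ge0 ltW.
apply: ub_le_sup; first exact: opnorm_has_ubound.
exists ((norm2 v)^-1%:C *: v) => //=.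
by rewrite norm2_scaler ger0_norm ?invr_ge0 ?(ltW p)// mulVf ?gt_eqF.
Qed.

Lemma opnorm_ge0 n m (A : 'M[C]_(n, m)) : 0 <= opnorm A.
Proof.
apply: (@le_trans _ _ (norm2 (A *m 0))); first exact: norm2_ge0.
apply: ub_le_sup; first exact: opnorm_has_ubound.
exists 0 => //=; suff -> : norm2 (0 : 'cV[C]_m) = 0 by [].
by apply/eqP; rewrite -sqrf_eq0 norm2_sqr big1// => i _; rewrite mxE /sqmod /= expr0n addr0.
Qed.

End Forms.

(** * Singular values and the Hermitian dilation *)

Section Linear.
Variable R : realType.
Local Notation C := R[i].

(** Sorting only permutes the spectrum, so a count over ranked singular
    values is a count over unordered eigenvalues of the Gram matrix. *)
Lemma card_singular_values (p : pred R) n m (A : 'M[C]_(n, m)) :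
  #|[set j : 'I_n | p (singular_value A j)]%SET| =
  #|[set i | p (Num.sqrt (Re (spectral_diag (A *m A^t*) 0 i)))]%SET|.
Proof.
pose lam i := Re (spectral_diag (A *m A^t*) 0 i).
pose s := sort (fun x y : R => y <= x) [seq lam i | i <- enum 'I_n].
have ss : size s = n by rewrite size_sort size_map size_enum_ord.
have -> : #|[set i | p (Num.sqrt (lam i))]%SET| = count (p \o Num.sqrt) s.
  rewrite (permP (permEl (perm_sort (fun x y : R => y <= x) _))).
  rewrite count_map cardE {1}/enum_mem -enumT size_filter.
  by apply: eq_count => i; rewrite -[LHS]/(i \in _) inE.
rewrite -!sum1_card -sum1_count (big_nth 0) ss big_mkord.
by apply: eq_bigl => j; rewrite inE.
Qed.

(** The constant Hermitian unitary J with K = D J D, where D is the diagonal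
    matrix carrying the square roots of the spikes twice. It has signature
    (r, r). *)
Definition swap_mx r : 'M[C]_(r + r) := block_mx 0 1%:M 1%:M 0.

Lemma swap_mx_adj r : (swap_mx r)^t* = swap_mx r.
Proof. by rewrite adjmx_block !adjmx0 !adjmx1. Qed.

Lemma swap_mxK r : swap_mx r *m swap_mx r = 1%:M.
Proof.
by rewrite mulmx_block !(mul0mx, mulmx0, mul1mx, addr0, add0r) -scalar_mx_block.
Qed.

Lemma norm2_swap r (v : 'cV_(r + r)) : norm2 (swap_mx r *m v) = norm2 v.
Proof.
apply/eqP; rewrite -(@eqrXn2 _ 2) ?norm2_ge0//; apply/eqP.
by rewrite -hform_gram swap_mx_adj swap_mxK (@hform_scalar _ _ 1) mul1r.
Qed.

Lemma form_dim_swap_ge r : form_dim (fun x => 0 <= x) (swap_mx r) r.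
Proof.
exists (col_mx 1%:M 1%:M) => x x0.
rewrite mul_col_mx mul1mx col_mx_eq0 negb_and x0; split=> //.
rewrite -[col_mx x x](_ : col_mx 1%:M 1%:M *m x = _); last by rewrite mul_col_mx mul1mx.
rewrite -hform_congr adjmx_col !adjmx1 mul_row_block mul_row_col.
rewrite !(mul0mx, mulmx0, mul1mx, mulmx1, addr0, add0r) hformD (@hform_scalar _ _ 1).
by rewrite mul1r addr_ge0 ?sqr_ge0.
Qed.

Lemma form_dim_swap_le r : form_dim (fun x => x <= 0) (swap_mx r) r.
Proof.
exists (col_mx 1%:M (- 1%:M)) => x x0.
rewrite -hform_congr mul_col_mx mul1mx col_mx_eq0 negb_and x0; split=> //.
rewrite adjmx_col adjmxN !adjmx1 mul_row_block mul_row_col.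
rewrite !(mul0mx, mulmx0, mul1mx, mulmx1, mulNmx, mulmxN, addr0, add0r) hformB hformN.
by rewrite (@hform_scalar _ _ 1) mul1r subr_le0 (@le_trans _ _ 0)// ?oppr_le0 ?sqr_ge0.
Qed.

Lemma linX_adj n m (A : 'M[C]_(n, m)) : (linX A)^t* = linX A.
Proof. by rewrite /linX adjmx_block !adjmx0 trmxCK. Qed.

Lemma resolvent_adj n m (A : 'M[C]_(n, m)) (z : R) :
  (z%:C%:M - linX A)^t* = z%:C%:M - linX A.
Proof. by rewrite adjmxD adjmxN linX_adj adjmx_scalar. Qed.

Lemma linX_block n m (A : 'M[C]_(n, m)) (z : C) :
  z%:M - linX A = block_mx z%:M (- A) (- A^t*) z%:M.
Proof. by rewrite scalar_mx_block opp_block_mx add_block_mx !(oppr0, addr0, add0r). Qed.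

Lemma realCV (z : R) : z != 0 -> z%:C * (z^-1)%:C = 1 :> C.
Proof. by move=> z0; rewrite -rmorphM mulfV. Qed.

(** Eliminating one of the two diagonal blocks z of the dilation leaves
    z - A^* A / z or z - A A^* / z. *)
Lemma form_dim_lin_right (P : pred R) n m (A : 'M[C]_(n, m)) (z : R) k : z != 0 ->
  form_dim P (z%:C%:M - linX A) k <->
  form_dim P (block_mx (z%:C%:M : 'M[C]_n) 0 0 (z%:C%:M - z^-1%:C *: (A^t* *m A))) k.
Proof.
move=> z0; rewrite linX_block.
have e : z%:C%:M *m (- (z^-1%:C *: A)) = - A.
  by rewrite mulmxN mul_scalar_mx scalerA realCV// scale1r.
rewrite -{1}e (_ : - A^t* = (z%:C%:M *m (- (z^-1%:C *: A)))^t*); last first.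
  by rewrite e adjmxN.
rewrite form_dim_schur_ul; last exact: adjmx_scalar.
by rewrite -mulmxA e adjmxN adjmx_scale mulmxN mulNmx opprK -scalemxAl.
Qed.

Lemma form_dim_lin_left (P : pred R) n m (A : 'M[C]_(n, m)) (z : R) k : z != 0 ->
  form_dim P (z%:C%:M - linX A) k <->
  form_dim P (block_mx (z%:C%:M - z^-1%:C *: (A *m A^t*)) 0 0 (z%:C%:M : 'M[C]_m)) k.
Proof.
move=> z0; rewrite linX_block.
have e : z%:C%:M *m (- (z^-1%:C *: A^t*)) = - A^t*.
  by rewrite mulmxN mul_scalar_mx scalerA realCV// scale1r.
rewrite -{1}e (_ : - A = (z%:C%:M *m (- (z^-1%:C *: A^t*)))^t*); last first.
  by rewrite e adjmxN trmxCK.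
rewrite form_dim_schur_dr; last exact: adjmx_scalar.
by rewrite -mulmxA e adjmxN adjmx_scale trmxCK mulmxN mulNmx opprK -scalemxAl.
Qed.

Lemma form_dim_gram_shift (P : pred R) n m (A : 'M[C]_(n, m)) (z : R) : cone P ->
  form_dim P (z%:C%:M - z^-1%:C *: (A *m A^t*))
    #|[set i | P (z - z^-1 * Re (spectral_diag (A *m A^t*) 0 i))]%SET|.
Proof.
move=> cP; set H := A *m A^t*.
have hH : H^t* = H by rewrite /H adjmxM trmxCK.
have U := spectral_unitarymx H.
have -> : z%:C%:M - z^-1%:C *: H = (spectralmx H)^t* *m
   diag_mx (const_mx z%:C - z^-1%:C *: spectral_diag H) *m spectralmx H.
  have -> : diag_mx (const_mx z%:C - z^-1%:C *: spectral_diag H) =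
      z%:C%:M - z^-1%:C *: diag_mx (spectral_diag H).
    by apply/matrixP => i j; rewrite !mxE mulrnBl mulrnAr.
  rewrite mulmxBr mulmxBl -scalemxAr -scalemxAl -hermitian_spectral//.
  rewrite mul_mx_scalar -scalemxAl -invmx_unitary// mulVmx ?spectral_unit//.
  by rewrite scalemx1.
apply/form_dim_congr; first exact: spectral_unit.
have -> : [set i | P (z - z^-1 * Re (spectral_diag H 0 i))]%SET =
  [set i | P (Re ((const_mx z%:C - z^-1%:C *: spectral_diag H) 0 i))]%SET.
  by apply/setP => i; rewrite !inE !mxE ReD ReN ReZ.
exact: form_dim_diag.
Qed.

(** The form of z - A^* A / z at v is (z^2 |v|^2 - |A v|^2) / z. *)
Lemma resolvent_pos n m (A : 'M[C]_(n, m)) (z : R) : 0 < z -> opnorm A < z ->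
  form_dim (fun x => 0 < x) (z%:C%:M - linX A) (n + m).
Proof.
move=> z0 Az; apply/form_dim_lin_right; first by rewrite gt_eqF.
apply: form_dim_block; first exact: cone_gt.
  apply: form_dim_full => v v0; rewrite hform_scalar mulr_gt0// exprn_gt0//.
  exact: norm2_gt0.
apply: form_dim_full => v v0; rewrite hformB hform_scalar hformZ hform_gram.
rewrite subr_gt0 mulrC ltr_pdivrMr// mulrAC -expr2 -exprMn.
rewrite ltr_pXn2r ?nnegrE ?norm2_ge0 ?mulr_ge0 ?norm2_ge0 ?(ltW z0)//.
by apply: (le_lt_trans (opnormP A v)); rewrite ltr_pM2r// norm2_gt0.
Qed.

End Linear.

(** * The model matrix and its symmetrized error *)

Section Spikes.
Variable R : realType.
Local Notation C := R[i].

Definition rdiag n (l : 'I_n -> R) : 'M[C]_n := diag_mx (\row_i (l i)%:C).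

Lemma rdiagM n (k l : 'I_n -> R) : rdiag k *m rdiag l = rdiag (fun i => k i * l i).
Proof.
rewrite /rdiag mulmx_diag; congr diag_mx.
by apply/rowP => i; rewrite !mxE -rmorphM.
Qed.

Lemma rdiagD n (k l : 'I_n -> R) : rdiag k + rdiag l = rdiag (fun i => k i + l i).
Proof.
by rewrite /rdiag -linearD; congr diag_mx; apply/rowP => i; rewrite !mxE -rmorphD.
Qed.

Lemma rdiagN n (k : 'I_n -> R) : - rdiag k = rdiag (fun i => - k i).
Proof.
by rewrite /rdiag -linearN; congr diag_mx; apply/rowP => i; rewrite !mxE -rmorphN.
Qed.

Lemma rdiag_scalar n (a : R) : a%:C%:M = rdiag (fun=> a) :> 'M[C]_n.
Proof. by rewrite -diag_const_mx; congr diag_mx; apply/rowP => i; rewrite !mxE. Qed.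

Lemma eq_rdiag n (k l : 'I_n -> R) : k =1 l -> rdiag k = rdiag l.
Proof. by move=> kl; congr diag_mx; apply/rowP => i; rewrite !mxE kl. Qed.

Lemma form_dim_rdiag (P : pred R) N (l : 'I_N -> R) :
  cone P -> form_dim P (rdiag l) #|[set i | P (l i)]%SET|.
Proof.
move=> cP; have -> : [set i | P (l i)]%SET =
    [set i | P (Re ((\row_i (l i)%:C : 'rV[C]_N) 0 i))]%SET.
  by apply/setP => i; rewrite !inE mxE.
exact: form_dim_diag.
Qed.

(** The matrix D of the square roots of the spikes. Conjugating by D moves
    the unbounded spikes from J to the resolvent side, where they turn into a
    bounded Hermitian error. *)
Definition spike_root r (theta : 'I_r -> R) : 'M[C]_(r + r) :=
  block_mx (rdiag (fun i => Num.sqrt (theta i))) 0 0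
           (rdiag (fun i => Num.sqrt (theta i))).

Lemma spike_root_adj r (theta : 'I_r -> R) : (spike_root theta)^t* = spike_root theta.
Proof. by rewrite adjmx_block !adjmx0 !adjmx_rdiag. Qed.

Lemma spike_root_sqr r (theta : 'I_r -> R) : (forall i, 0 < theta i) ->
  spike_root theta *m spike_root theta = block_mx (theta_mx theta) 0 0 (theta_mx theta).
Proof.
move=> t0; rewrite mulmx_block !(mul0mx, mulmx0, addr0, add0r) !rdiagM.
by rewrite (@eq_rdiag _ _ theta)// => i; rewrite -expr2 sqr_sqrtr// ltW.
Qed.

Lemma spikeK_swap r (theta : 'I_r -> R) : (forall i, 0 < theta i) ->
  spikeK theta = swap_mx R r *m spike_root theta *m spike_root theta.
Proof.
move=> t0; rewrite -mulmxA spike_root_sqr// mulmx_block.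
by rewrite !(mul0mx, mulmx0, mul1mx, addr0, add0r).
Qed.

Lemma spike_root_swap r (theta : 'I_r -> R) : (forall i, 0 < theta i) ->
  spike_root theta *m swap_mx R r *m spike_root theta = spikeK theta.
Proof.
move=> t0; rewrite (spikeK_swap t0); congr (_ *m _).
by rewrite 2!mulmx_block !(mul0mx, mulmx0, mul1mx, mulmx1, addr0, add0r).
Qed.

Lemma spike_root_unit r (theta : 'I_r -> R) : (forall i, 0 < theta i) ->
  spike_root theta \in unitmx.
Proof.
move=> t0; pose E := rdiag (fun i => (Num.sqrt (theta i))^-1).
suff /mulmx1_unit[] : spike_root theta *m block_mx E 0 0 E = 1%:M by [].
rewrite mulmx_block !(mul0mx, mulmx0, addr0, add0r) rdiagM.
rewrite (@eq_rdiag _ _ (fun=> 1)); last by move=> i; rewrite mulfV// gt_eqF ?sqrtr_gt0.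
by rewrite -rdiag_scalar -scalar_mx_block.
Qed.

(** An eigenvector x of Q gives the vector D x, which B stretches by the
    modulus of the eigenvalue, J being isometric. *)
Lemma opnorm_eigen N (B D Q J : 'M[C]_N) (lam : C) (x : 'cV[C]_N) :
  (forall v : 'cV[C]_N, norm2 (J *m v) = norm2 v) -> B *m D = J *m D *m Q ->
  Q *m x = lam *: x -> D *m x != 0 -> sqmod lam <= opnorm B ^+ 2.
Proof.
move=> hJ BD Qx Dx0; have p := norm2_gt0 Dx0.
have := opnormP B (D *m x); rewrite mulmxA BD -mulmxA Qx -mulmxA hJ.
rewrite -scalemxAr => h.
rewrite -(@ler_pM2r _ (norm2 (D *m x) ^+ 2)) ?exprn_gt0// -norm2_scale -exprMn.
by rewrite ler_pXn2r// nnegrE ?norm2_ge0// mulr_ge0 ?norm2_ge0 ?opnorm_ge0.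
Qed.

(** An eigenvalue of the Hermitian matrix D Dl D is an eigenvalue of D^2 Dl,
    hence bounded by the norm of J D^2 Dl = K Dl. The one-sided weighted error
    thus controls the symmetric one, although D alone is unbounded. *)
Lemma symmetrized_bound r (theta : 'I_r -> R) (Dl : 'M[C]_(r + r)) v :
  (forall i, 0 < theta i) -> Dl^t* = Dl ->
  `|hform (spike_root theta *m Dl *m spike_root theta) v| <=
    opnorm (spikeK theta *m Dl) * norm2 v ^+ 2.
Proof.
move=> t0 hDl; set D := spike_root theta; set Q := D *m Dl *m D; set e := opnorm _.
have hQ : Q^t* = Q by rewrite /Q !adjmxM spike_root_adj hDl mulmxA.
set S := spectralmx Q; have uS : S \is unitarymx := spectral_unitarymx Q.
have SS : S *m S^t* = 1%:M by apply/unitarymxP.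
have le_e i : `|Re (spectral_diag Q 0 i)| <= e.
  set lam := spectral_diag Q 0 i.
  pose x : 'cV[C]_(r + r) := S^t* *m delta_mx i 0.
  have x0 : x != 0.
    apply/eqP => /(congr1 (mulmx S)); rewrite mulmxA SS mul1mx mulmx0.
    by move/colP/(_ i)/eqP; rewrite !mxE !eqxx oner_eq0.
  have Qx : Q *m x = lam *: x.
    rewrite {1}[Q]hermitian_spectral// -!mulmxA (mulmxA S) SS mul1mx.
    rewrite /x scalemxAr; congr (_ *m _); apply/colP => j.
    rewrite mul_diag_mx !mxE eqxx andbT.
    by case: eqP => [->|_]; rewrite ?mulr0.
  have Dx0 : D *m x != 0.
    apply: contra x0 => /eqP /(congr1 (mulmx (invmx D))).
    by rewrite mulKmx ?spike_root_unit// mulmx0 => ->.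
  have h : sqmod lam <= e ^+ 2.
    apply: (opnorm_eigen (@norm2_swap R r) _ Qx Dx0).
    by rewrite (spikeK_swap t0) /Q -/D !mulmxA.
  rewrite -(@ler_pXn2r _ 2) ?nnegrE ?opnorm_ge0// real_normK ?num_real//.
  by apply: le_trans h; rewrite lerDl sqr_ge0.
rewrite [Q]hermitian_spectral// hform_congr -/S.
have -> : norm2 v ^+ 2 = norm2 (S *m v) ^+ 2.
  rewrite -hform_gram -[S^t*]invmx_unitary// mulVmx ?spectral_unit//.
  by rewrite (@hform_scalar _ _ 1) mul1r.
rewrite hform_diag norm2_sqr mulr_sumr.
apply: (le_trans (ler_norm_sum _ _ _)); apply: ler_sum => i _.
by rewrite normrM (ger0_norm (sqmod_ge0 _)) ler_wpM2r// sqmod_ge0.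
Qed.

(** Columns (q, p) and (q, -p), repeated for each spike. With p^2 = phi and
    q^2 = phit they are orthogonal for every form
    [[- phi theta, 1], [1, - phit theta]] at once: the frame diagonalizes the
    model matrix and does not depend on the spikes, which is what makes the
    gap below uniform in their size and number. *)
Definition model_frame r (p q : R) : 'M[C]_(r + r) :=
  block_mx q%:C%:M q%:C%:M p%:C%:M (- p)%:C%:M.

Lemma model_frame_unit r (p q : R) : p != 0 -> q != 0 -> model_frame r p q \in unitmx.
Proof.
move=> p0 q0.
pose E : 'M[C]_(r + r) := block_mx ((2 * q)^-1%:C%:M) ((2 * p)^-1%:C%:M)
  ((2 * q)^-1%:C%:M) ((- (2 * p)^-1)%:C%:M).
suff /mulmx1_unit[] : model_frame r p q *m E = 1%:M by [].
rewrite mulmx_block -!scalar_mxM -!raddfD /= -!rmorphM -!rmorphD /=.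
rewrite [1%:M]scalar_mx_block.
have e2 : 2 != 0 :> R by rewrite pnatr_eq0.
congr block_mx; first [by congr (_%:C%:M); field; rewrite ?p0 ?q0 |
  rewrite [X in X%:C%:M](_ : _ = 0) ?raddf0//; field; rewrite ?p0 ?q0//].
Qed.

Lemma norm2D_sqr n (x y : 'cV[C]_n) :
  norm2 (x + y) ^+ 2 <= 2 * (norm2 x ^+ 2 + norm2 y ^+ 2).
Proof.
rewrite (norm2_sqr (x + y)) (norm2_sqr x) (norm2_sqr y) -big_split mulr_sumr.
apply: ler_sum => i _; rewrite mxE /=.
case: (x i 0) (y i 0) => a b [a' b']; rewrite /sqmod /=.
have := sqr_ge0 (a - a'); have := sqr_ge0 (b - b'); nra.
Qed.

(** The constant is free of r, so that the perturbation bound does not see the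
    rank. *)
Lemma model_frame_norm r (p q : R) (v : 'cV_(r + r)) :
  norm2 (model_frame r p q *m v) ^+ 2 <= 2 * (p ^+ 2 + q ^+ 2) * norm2 v ^+ 2.
Proof.
rewrite -[v]vsubmxK mul_block_col !norm2_col !mul_scalar_mx.
move: (usubmx v) (dsubmx v) => x y.
have bound a b : a ^+ 2 = b ^+ 2 ->
    norm2 (a%:C *: x + b%:C *: y) ^+ 2 <=
    2 * a ^+ 2 * (norm2 x ^+ 2 + norm2 y ^+ 2).
  move=> ab; apply: (le_trans (norm2D_sqr _ _)).
  rewrite !norm2_scaler 2!exprMn !real_normK ?num_real//.
  by rewrite -ab -mulrDr mulrA.
have collect A B s : A <= 2 * q ^+ 2 * s -> B <= 2 * p ^+ 2 * s ->
    A + B <= 2 * (p ^+ 2 + q ^+ 2) * s by lra.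
have := collect _ _ _ (bound q q erefl) (bound p (- p) (esym (sqrrN p))).
by apply.
Qed.

(** The algebra of 2 x 2 matrices of real diagonal matrices, in which an
    identity can be checked spike by spike. *)
Definition rdiag_block r (a b c d : 'I_r -> R) : 'M[C]_(r + r) :=
  block_mx (rdiag a) (rdiag b) (rdiag c) (rdiag d).

Lemma rdiag_blockM r (a b c d a' b' c' d' : 'I_r -> R) :
  rdiag_block a b c d *m rdiag_block a' b' c' d' =
  rdiag_block (fun i => a i * a' i + b i * c' i) (fun i => a i * b' i + b i * d' i)
              (fun i => c i * a' i + d i * c' i) (fun i => c i * b' i + d i * d' i).
Proof. by rewrite /rdiag_block mulmx_block !rdiagM !rdiagD. Qed.

Lemma rdiag_blockB r (a b c d a' b' c' d' : 'I_r -> R) :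
  rdiag_block a b c d - rdiag_block a' b' c' d' =
  rdiag_block (fun i => a i - a' i) (fun i => b i - b' i)
              (fun i => c i - c' i) (fun i => d i - d' i).
Proof. by rewrite /rdiag_block opp_block_mx add_block_mx !rdiagN !rdiagD. Qed.

Lemma eq_rdiag_block r (a b c d a' b' c' d' : 'I_r -> R) :
  a =1 a' -> b =1 b' -> c =1 c' -> d =1 d' ->
  rdiag_block a b c d = rdiag_block a' b' c' d'.
Proof. by move=> ha hb hc hd; congr block_mx; exact: eq_rdiag. Qed.

Lemma rdiag0 n : rdiag (fun=> 0) = 0 :> 'M[C]_n.
Proof. by rewrite -rdiag_scalar raddf0. Qed.

Lemma model_congr r (theta : 'I_r -> R) (p q : R) : (forall i, 0 < theta i) ->
  (model_frame r p q)^t* *m (swap_mx R r - spike_root theta *m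
     block_mx ((p ^+ 2)%:C%:M) 0 0 ((q ^+ 2)%:C%:M) *m spike_root theta)
    *m model_frame r p q =
  block_mx (rdiag (fun i => 2 * (p * q) * (1 - p * q * theta i))) 0 0
           (rdiag (fun i => - (2 * (p * q) * (1 + p * q * theta i)))).
Proof.
move=> t0.
have [s -> t2] : exists2 s : 'I_r -> R,
    spike_root theta = rdiag_block s (fun=> 0) (fun=> 0) s & forall i, theta i = s i ^+ 2.
  exists (fun i => Num.sqrt (theta i)); first by rewrite /rdiag_block rdiag0.
  by move=> i; rewrite sqr_sqrtr// ltW.
have -> : model_frame r p q = rdiag_block (fun=> q) (fun=> q) (fun=> p) (fun=> - p).
  by rewrite /rdiag_block -!rdiag_scalar.
have -> : (rdiag_block (fun=> q) (fun=> q) (fun=> p) (fun=> - p))^t* =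
    rdiag_block (r := r) (fun=> q) (fun=> p) (fun=> q) (fun=> - p).
  by rewrite adjmx_block !adjmx_rdiag.
have -> : swap_mx R r = rdiag_block (fun=> 0) (fun=> 1) (fun=> 1) (fun=> 0).
  by rewrite /rdiag_block rdiag0 -rdiag_scalar.
have -> : block_mx ((p ^+ 2)%:C%:M) 0 0 ((q ^+ 2)%:C%:M) =
    rdiag_block (r := r) (fun=> p ^+ 2) (fun=> 0) (fun=> 0) (fun=> q ^+ 2).
  by rewrite /rdiag_block rdiag0 -!rdiag_scalar.
have <- : rdiag_block (fun i => 2 * (p * q) * (1 - p * q * theta i)) (fun=> 0)
     (fun=> 0) (fun i => - (2 * (p * q) * (1 + p * q * theta i))) =
  block_mx (rdiag (fun i => 2 * (p * q) * (1 - p * q * theta i))) 0 0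
           (rdiag (fun i => - (2 * (p * q) * (1 + p * q * theta i)))).
  by rewrite /rdiag_block rdiag0.
rewrite 2!rdiag_blockM rdiag_blockB 2!rdiag_blockM.
apply: eq_rdiag_block => i /=.
all: by rewrite ?t2; ring.
Qed.

End Spikes.

(** * Counting singular values above a point *)

Section Count.
Variable R : realType.
Local Notation C := R[i].

Lemma dist_neg (a b c : R) : `|a - b| <= c -> b + c < 0 -> a < 0.
Proof. by rewrite ler_norml; lra. Qed.

Lemma dist_pos (a b c : R) : `|a - b| <= c -> 0 < b - c -> 0 < a.
Proof. by rewrite ler_norml; lra. Qed.

(** Here p^2 and q^2 stand for phi and phit, t = 1 / (p q) for the critical
    spike strength, Dl for the error of the compressed resolvent. *)
Section Signature.
Variables (r : nat) (theta : 'I_r -> R) (p q gam : R) (Dl : 'M[C]_(r + r)).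
Let t := (p * q)^-1.
Hypotheses (theta0 : forall i, 0 < theta i) (p0 : 0 < p) (q0 : 0 < q)
  (gap : forall i, gam <= `|theta i - t|) (hDl : Dl^t* = Dl).
Let eta := opnorm (spikeK theta *m Dl) * (2 * (p ^+ 2 + q ^+ 2)).
Hypotheses (eta_gam : eta < 2 * (p * q) ^+ 2 * gam) (eta_t : eta < 2 * (p * q)).

Let M : 'M[C]_(r + r) := block_mx ((p ^+ 2)%:C%:M) 0 0 ((q ^+ 2)%:C%:M).
Let H := swap_mx R r - spike_root theta *m (M + Dl) *m spike_root theta.
Let L := block_mx (rdiag (fun i => 2 * (p * q) * (1 - p * q * theta i))) 0 0
           (rdiag (fun i => - (2 * (p * q) * (1 + p * q * theta i)))).

Lemma frame_perturbation v :
  `|hform ((model_frame r p q)^t* *m H *m model_frame r p q) v - hform L v| <=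
  eta * norm2 v ^+ 2.
Proof.
have -> : H = (swap_mx R r - spike_root theta *m M *m spike_root theta)
    - spike_root theta *m Dl *m spike_root theta.
  by rewrite /H mulmxDr mulmxDl opprD addrA.
rewrite mulmxBr mulmxBl hformB model_congr// addrAC subrr add0r normrN.
rewrite hform_congr; apply: (le_trans (symmetrized_bound _ theta0 hDl)).
by rewrite /eta -mulrA ler_wpM2l ?opnorm_ge0// model_frame_norm.
Qed.

(** The diagonal entry of the model equals 2 (p q)^2 (t - theta i); the gap
    hypothesis keeps it farther than eta from zero. *)
Lemma gap_sign i : (2 * (p * q) * (1 - p * q * theta i) + eta < 0) = (t < theta i) /\
   (0 < 2 * (p * q) * (1 - p * q * theta i) - eta) = (theta i < t).
Proof.
have pq0 : 0 < p * q by rewrite mulr_gt0.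
have e : 2 * (p * q) * (1 - p * q * theta i) = 2 * (p * q) ^+ 2 * (t - theta i).
  by rewrite /t; field; rewrite !gt_eqF.
have c0 : 0 < 2 * (p * q) ^+ 2 by rewrite mulr_gt0// exprn_gt0.
have eta0 : 0 <= eta.
  by rewrite mulr_ge0 ?opnorm_ge0// mulr_ge0// addr_ge0 ?sqr_ge0.
have := gap i; have := eta_gam; rewrite e; move: c0 eta0; set k := 2 * (p * q) ^+ 2.
move: eta => h k0 h0 hk hg.
have [lt|lt|eq] := ltgtP (theta i) t; split.
- apply/negbTE; rewrite -leNgt addr_ge0// mulr_ge0// ltW//; lra.
- rewrite ltr0_norm ?subr_lt0// in hg; rewrite subr_gt0; apply: (lt_le_trans hk).
  by rewrite ler_pM2l//; lra.
- rewrite gtr0_norm ?subr_gt0// in hg.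
  have : k * gam <= k * (theta i - t) by rewrite ler_pM2l.
  by rewrite -opprB mulrN; lra.
- apply/negbTE; rewrite -leNgt subr_le0 (@le_trans _ _ 0)// pmulr_rle0//; lra.
- by rewrite eq subrr mulr0 add0r; apply/negbTE; rewrite -leNgt.
- by rewrite eq subrr mulr0 sub0r; apply/negbTE; rewrite -leNgt oppr_le0.
Qed.

Lemma form_dim_perturbed_neg :
  form_dim (fun x => x < 0) H (#|[set i | t < theta i]%SET| + r).
Proof.
have uC : model_frame r p q \in unitmx by rewrite model_frame_unit// gt_eqF.
apply/(form_dim_congr _ _ _ uC).
pose E1 := rdiag (fun i => 2 * (p * q) * (1 - p * q * theta i) + eta).
pose E2 := rdiag (fun i => - (2 * (p * q) * (1 + p * q * theta i)) + eta).
apply: (@form_dim_mono R _ _ (block_mx E1 0 0 E2)).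
  have -> : block_mx E1 0 0 E2 = L + eta%:C%:M.
    by rewrite scalar_mx_block add_block_mx !addr0 !rdiag_scalar !rdiagD.
  move=> v; rewrite hformD hform_scalar.
  by apply: dist_neg; apply: frame_perturbation.
apply: form_dim_block; first exact: cone_lt.
  have -> : [set i | t < theta i]%SET =
      [set i | 2 * (p * q) * (1 - p * q * theta i) + eta < 0]%SET.
    by apply/setP => i; rewrite !inE (gap_sign i).1.
  exact/form_dim_rdiag/cone_lt.
have := @form_dim_rdiag R (fun x => x < 0) _
  (fun i : 'I_r => - (2 * (p * q) * (1 + p * q * theta i)) + eta) (@cone_lt R).
rewrite (_ : [set i | _]%SET = [set: 'I_r]%SET) ?cardsT ?card_ord//.
apply/setP => i; rewrite !inE.
have pq0 : 0 < p * q by rewrite mulr_gt0.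
have := mulr_gt0 (mulr_gt0 pq0 pq0) (theta0 i).
by move: eta_t; move: eta => h; nra.
Qed.

Lemma form_dim_perturbed_pos :
  form_dim (fun x => 0 < x) H #|[set i | theta i < t]%SET|.
Proof.
have uC : model_frame r p q \in unitmx by rewrite model_frame_unit// gt_eqF.
apply/(form_dim_congr _ _ _ uC).
pose E1 := rdiag (fun i => 2 * (p * q) * (1 - p * q * theta i) - eta).
pose E2 := rdiag (fun i => - (2 * (p * q) * (1 + p * q * theta i)) - eta).
apply: (@form_dim_mono R _ _ (block_mx E1 0 0 E2)).
  have -> : block_mx E1 0 0 E2 = L - eta%:C%:M.
    rewrite scalar_mx_block opp_block_mx add_block_mx !oppr0 !addr0.
    by rewrite !rdiag_scalar !rdiagN !rdiagD.
  move=> v; rewrite hformB hform_scalar.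
  by apply: dist_pos; apply: frame_perturbation.
rewrite -[#|_|]addn0; apply: form_dim_block; first exact: cone_gt.
  have -> : [set i | theta i < t]%SET =
      [set i | 0 < 2 * (p * q) * (1 - p * q * theta i) - eta]%SET.
    by apply/setP => i; rewrite !inE (gap_sign i).2.
  exact/form_dim_rdiag/cone_gt.
exact: form_dim0.
Qed.

End Signature.

(** The left-hand sides are governed by the sign of z^2 - x; for negative x the
    square root takes its default value zero, on the same side of z. *)
Lemma gram_shift_sign (z x : R) : 0 < z ->
  ((z - z^-1 * x < 0) = (z < Num.sqrt x)) *
  ((0 <= z - z^-1 * x) = ~~ (z < Num.sqrt x)) *
  ((z - z^-1 * x <= 0) = (z <= Num.sqrt x)).
Proof.
move=> z0; have e : z - z^-1 * x = z^-1 * (z ^+ 2 - x) by field; rewrite gt_eqF.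
have iz : 0 < z^-1 by rewrite invr_gt0.
have lt : (z < Num.sqrt x) = (z ^+ 2 < x).
  rewrite -{1}[z](@ger0_norm R) ?(ltW z0)// -sqrtr_sqr.
  have [x0|x0] := ltrP 0 x; first by rewrite ltr_sqrt.
  rewrite [Num.sqrt x]ler0_sqrtr// ltNge sqrtr_ge0/=; apply/esym/negbTE.
  by rewrite -leNgt (le_trans x0)// sqr_ge0.
have le : (z <= Num.sqrt x) = (z ^+ 2 <= x).
  have [x0|x0] := ltrP 0 x.
    by rewrite -{1}[z](@ger0_norm R) ?(ltW z0)// -sqrtr_sqr ler_sqrt// ltW.
  rewrite ler0_sqrtr// leNgt z0/=; apply/esym/negbTE.
  by rewrite -ltNge (le_lt_trans x0)// exprn_gt0.
rewrite e lt le pmulr_rlt0// pmulr_rge0// pmulr_rle0// subr_lt0 subr_ge0 subr_le0.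
by rewrite leNgt.
Qed.

Lemma frameE_spikeK n m r (U : 'M[C]_(n, r)) (V : 'M[C]_(m, r)) (theta : 'I_r -> R) :
  frameE U V *m spikeK theta *m (frameE U V)^t* =
  linX (U *m theta_mx theta *m V^t*).
Proof.
rewrite /frameE adjmx_block !adjmx0 !mulmx_block !(mul0mx, mulmx0, addr0, add0r).
by rewrite /linX !adjmxM trmxCK adjmx_rdiag mulmxA.
Qed.

Lemma linXD n m (A B : 'M[C]_(n, m)) : linX (A + B) = linX A + linX B.
Proof. by rewrite /linX adjmxD add_block_mx !addr0. Qed.

(** The bordered matrix [[z - linX X, E D], [D E^*, J]] is congruent both to
    (z - linX X) + (J - D G D) and to (z - linX W) + J, the sums being orthogonal.
    The first form is nondegenerate with a + r negative squares, a being the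
    number of spikes above t; the second one has r negative squares from J and
    the remaining ones from z - W W^* / z. Strict signs in the first reading
    against large signs in the second one bound the number of singular values
    exceeding z from below by a, and of those at least z from above by a. *)
Theorem spike_count n m r (X : 'M[C]_(n, m)) (U : 'M[C]_(n, r)) (V : 'M[C]_(m, r))
    (theta : 'I_r -> R) (z f g gam : R) (G := compG X U V z%:C)
    (M := block_mx f%:C%:M 0 0 g%:C%:M : 'M[C]_(r + r))
    (t := (Num.sqrt (f * g))^-1)
    (eta := opnorm (spikeK theta *m (G - M)) * (2 * (f + g))) :
  0 < z -> 0 < f -> 0 < g -> opnorm X < z -> resolvent_defined X z%:C ->
  (forall i, 0 < theta i) -> (forall i, gam <= `|theta i - t|) ->
  eta < 2 * (f * g) * gam -> eta < 2 * Num.sqrt (f * g) ->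
  let W := X + U *m theta_mx theta *m V^t* in
  #|[set j : 'I_n | z < singular_value W j]%SET| = #|[set i | t < theta i]%SET| /\
  forall j : 'I_n, singular_value W j != z.
Proof.
move=> z0 f0 g0 Xz uA t0 gap eta_gam eta_t W.
have zn0 : z != 0 by rewrite gt_eqF.
pose p := Num.sqrt f; pose q := Num.sqrt g.
have p0 : 0 < p by rewrite sqrtr_gt0.
have q0 : 0 < q by rewrite sqrtr_gt0.
have p2 : p ^+ 2 = f by rewrite sqr_sqrtr// ltW.
have q2 : q ^+ 2 = g by rewrite sqr_sqrtr// ltW.
have pq : Num.sqrt (f * g) = p * q by rewrite sqrtrM// ltW.
set A0 := z%:C%:M - linX X; have hA0 : A0^t* = A0 by exact: resolvent_adj.
have hA0V : (invmx A0)^t* = invmx A0 by rewrite trmx_inv map_invmx hA0.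

pose Y := frameE U V *m spike_root theta; pose J := swap_mx R r.
pose H2 := J - spike_root theta *m G *m spike_root theta.
have hJ : J^t* = J by exact: swap_mx_adj.
have YJY : Y *m J *m Y^t* = linX (U *m theta_mx theta *m V^t*).
  by rewrite /Y adjmxM spike_root_adj -frameE_spikeK -(spike_root_swap t0) !mulmxA.
have chain P k : form_dim P (block_mx A0 0 0 H2) k <->
    form_dim P (block_mx (z%:C%:M - linX W) 0 0 J) k.
  have AZ : A0 *m (invmx A0 *m Y) = Y by rewrite mulKVmx.
  have JZ : J *m (J *m Y^t*) = Y^t* by rewrite mulmxA swap_mxK mul1mx.
  have -> : block_mx A0 0 0 H2 =
      block_mx A0 0 0 (J - (invmx A0 *m Y)^t* *m A0 *m (invmx A0 *m Y)).
    congr (block_mx _ _ _ (J - _)).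
    rewrite -[RHS]mulmxA AZ adjmxM hA0V /Y adjmxM spike_root_adj /G /compG -/A0.
    by rewrite !mulmxA.
  rewrite -(form_dim_schur_ul _ _ _ _ hA0) AZ.
  have -> : block_mx (z%:C%:M - linX W) 0 0 J =
      block_mx (A0 - (J *m Y^t*)^t* *m J *m (J *m Y^t*)) 0 0 J.
    congr (block_mx _ _ _ _).
    by rewrite -mulmxA JZ adjmxM trmxCK hJ YJY /W linXD opprD addrA.
  by rewrite -(form_dim_schur_dr _ _ _ _ hJ) JZ trmxCK.
have linW P l k : cone P -> form_dim P (z%:C%:M : 'M[C]_m) l -> form_dim P J k ->
    form_dim P (block_mx (z%:C%:M - linX W) 0 0 J)
      (#|[set i | P (z - z^-1 * Re (spectral_diag (W *m W^t*) 0 i))]%SET|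
        + l + k).
  move=> cP dz dJ; apply: form_dim_block => //; apply/form_dim_lin_left => //.
  by apply: form_dim_block => //; exact: form_dim_gram_shift.
set a := #|[set i | t < theta i]%SET|; set b := #|[set i | theta i < t]%SET|.
have pq_t : t = (p * q)^-1 by rewrite /t pq.
have hDl : (G - M)^t* = G - M.
  rewrite adjmxD adjmxN /M adjmx_block !adjmx0 !adjmx_scalar; congr (_ - _).
  by rewrite /G /compG -/A0 !adjmxM trmxCK hA0V mulmxA.
have H2E : H2 = J - spike_root theta *m (block_mx ((p ^+ 2)%:C%:M) 0 0
    ((q ^+ 2)%:C%:M) + (G - M)) *m spike_root theta.
  by rewrite p2 q2 -/M (addrC M) subrK.
have H2neg : form_dim (fun x => x < 0) H2 (a + r).
  rewrite H2E /a pq_t; apply: (form_dim_perturbed_neg (gam := gam) t0 p0 q0 _ hDl).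
  - by rewrite -pq_t.
  - by rewrite p2 q2 exprMn p2 q2.
  - by rewrite p2 q2 -pq.
have H2pos : form_dim (fun x => 0 < x) H2 b.
  rewrite H2E /b pq_t; apply: (form_dim_perturbed_pos (gam := gam) t0 p0 q0 _ hDl).
  - by rewrite -pq_t.
  - by rewrite p2 q2 exprMn p2 q2.
have ab : (a + b = r)%N.
  have gam0 : 0 < gam.
    have fg0 : 0 < 2 * (f * g) by rewrite !mulr_gt0.
    rewrite -(pmulr_rgt0 _ fg0); apply: le_lt_trans eta_gam.
    apply: mulr_ge0; first exact: opnorm_ge0.
    by apply: mulr_ge0; rewrite ?addr_ge0 ?ltW.
  rewrite -[RHS]card_ord -(cardsC [set i | t < theta i]%SET); congr (_ + _)%N.
  apply: eq_card => i.
  have ne : theta i != t.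
    by apply/eqP => ti; move: (gap i); rewrite ti subrr normr0 leNgt gam0.
  by rewrite !inE -leNgt lt_neqAle ne.
pose lam i := Re (spectral_diag (W *m W^t*) 0 i).
pose sv i := Num.sqrt (lam i).
have zge : form_dim (fun x => 0 <= x) (z%:C%:M : 'M[C]_m) m.
  apply: form_dim_full => v _; rewrite hform_scalar; apply: mulr_ge0; first exact: ltW.
  exact: sqr_ge0.
have le_a : (a <= #|[set i | (z < sv i)%R]%SET|)%N.
  (* a + r negative directions against the nonnegative ones of the other form. *)
  have negT := iffLR (chain _ _) (form_dim_block (@cone_lt R) (form_dim0 _ A0) H2neg).
  have geT := linW _ _ _ (@cone_ge R) zge (@form_dim_swap_ge R r).
  have dis (x : R) : x < 0 -> 0 <= x -> False by move=> /lt_geF ->.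
  have := form_dim_disjoint dis negT geT.
  have -> : [set i | 0 <= z - z^-1 * lam i]%SET = (~: [set i | z < sv i])%SET.
    by apply/setP => i; rewrite !inE (gram_shift_sign (lam i) z0).
  have := cardsC [set i | z < sv i]%SET; rewrite card_ord.
  by move: #|_| #|_| => k1 k2; clear; lia.
have ge_a : (#|[set i | (z <= sv i)%R]%SET| <= a)%N.
  (* n + m + b positive directions against the nonpositive ones of the other form. *)
  have posT := iffLR (chain _ _) (form_dim_block (@cone_gt R) (resolvent_pos z0 Xz) H2pos).
  have leT := linW _ _ _ (@cone_le R) (form_dim0 _ _) (@form_dim_swap_le R r).
  have dis (x : R) : 0 < x -> x <= 0 -> False by move=> /lt_geF ->.
  have := form_dim_disjoint dis posT leT.
  have -> : [set i | z - z^-1 * lam i <= 0]%SET = [set i | z <= sv i]%SET.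
    by apply/setP => i; rewrite !inE (gram_shift_sign (lam i) z0).
  by move: ab; move: (a) (b) #|_| => k1 k2 k3; clear; lia.
pose S2 := [set j : 'I_n | z < singular_value W j]%SET.
pose S1 := [set j : 'I_n | z <= singular_value W j]%SET.
have c2 : #|S2| = #|[set i | z < sv i]%SET| := card_singular_values (fun x => z < x) W.
have c1 : #|S1| = #|[set i | z <= sv i]%SET| := card_singular_values (fun x => z <= x) W.
have S21 : S2 \subset S1 by apply/fintype.subsetP => j; rewrite !inE => /ltW.
have cS : #|S2| = a.
  apply/eqP; rewrite eqn_leq {2}c2 le_a andbT.
  by apply: leq_trans (subset_leq_card S21) _; rewrite c1.
split; first by apply: cS.
move=> j; apply/eqP => sj.
have /eqP/setP/(_ j) : S2 == S1 by rewrite eqEcard S21 cS c1.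
by rewrite !inE sj ltxx lexx.
Qed.
End Count.

(** * The transforms above the edge *)

Section Transforms.
Variables (R : realType) (mu : probability (measurableTypeR R) R).
Hypotheses (mu_pos : mu `[0, +oo[%classic = 1%E) (supp_compact : compact (supp mu)).

Let s := edge mu ^+ 2.
Let D : set (measurableTypeR R) := `[0, s]%classic.

Lemma edge_ge0 : 0 <= edge mu. Proof. exact: sqrtr_ge0. Qed.

Lemma supp_le_edge x : supp mu x -> x <= s.
Proof.
move=> sx; apply: (@le_trans _ _ (sup (supp mu))); last first.
  rewrite /s /edge; have [h|h] := lerP 0 (sup (supp mu)); first by rewrite sqr_sqrtr.
  by rewrite (le_trans (ltW h))// sqr_ge0.
apply: ub_le_sup => //; have [M [_ hM]] := compact_bounded supp_compact.
by exists (M + 1) => y /(hM (M + 1)); rewrite ltrDl ltr01 => /(_ isT)/ler_normlW.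
Qed.

(** Points outside the support have null neighbourhoods; rational intervals
    make the cover countable. *)
Lemma mu_above_edge : mu.-negligible (`]s, +oo[%classic : set (measurableTypeR R)).
Proof.
pose F k : set (measurableTypeR R) :=
  if @unpickle (rat * rat)%type k is Some (a, b) then
    if mu (`]ratr a, ratr b[%classic : set (measurableTypeR R)) == 0%E
    then `]ratr a, ratr b[%classic else set0
  else set0.
have Fneg k : mu.-negligible (F k).
  rewrite /F; case: unpickle => [[a b]|]; last exact: negligible_set0.
  case: eqP => [ab|_]; last exact: negligible_set0.
  exists (`]ratr a, ratr b[%classic : set (measurableTypeR R)).
  by split=> //; exact: measurable_itv.
apply: negligibleS (negligible_bigcup Fneg) => x /=; rewrite in_itv/= andbT => sx.
have : ~ supp mu x by move/supp_le_edge; rewrite leNgt sx.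
move/existsNP => [e /not_implyP[e0 /negP]]; rewrite -leNgt => ball0.
have xe1 : x - e < x by rewrite ltrBlDr ltrDl.
have xe2 : x < x + e by rewrite ltrDl.
have [a] := rat_in_itvoo xe1; rewrite in_itv /= => /andP[ea ax].
have [b] := rat_in_itvoo xe2; rewrite in_itv /= => /andP[xb be].
exists (pickle (a, b)); first by apply: I.
rewrite /F pickleK.
rewrite (_ : mu _ == 0%E); first by rewrite /= in_itv /= ax xb.
rewrite eq_le measure_ge0 andbT; apply: le_trans ball0; apply: le_measure.
- by rewrite inE; exact: measurable_itv.
- by rewrite inE ball_itv; exact: measurable_itv.
rewrite ball_itv => y /=; rewrite !in_itv /= => /andP[ay yb].
by rewrite (lt_trans ea ay) (lt_trans yb be).
Qed.

Lemma measurable_bulk : measurable D.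
Proof. exact: measurable_itv. Qed.

Lemma mu_outside_bulk : mu.-negligible (~` D).
Proof.
have m0 : measurable (`[0, +oo[%classic : set (measurableTypeR R)).
  exact: measurable_itv.
have n0 : mu.-negligible (~` (`[0, +oo[%classic : set (measurableTypeR R))).
  exists (~` (`[0, +oo[%classic : set (measurableTypeR R))); split=> //.
    exact: measurableC.
  by rewrite probability_setC// mu_pos subee.
apply: negligibleS (negligibleU n0 mu_above_edge) => x /=.
have [x0|x0] := ltrP x 0; first by move=> _; left; rewrite /setC /= in_itv /= leNgt x0.
have [xs|xs] := lerP x s; last by move=> _; right; rewrite /= in_itv /= xs.
by move=> nD; exfalso; apply: nD; rewrite /D /= in_itv /= x0 xs.
Qed.

Lemma mu_bulk : mu D = 1%E.
Proof.
have := mu_outside_bulk => /negligibleP h.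
have mC : measurable (~` D) by apply: measurableC; exact: measurable_bulk.
have := probability_setC mu mC; rewrite setCK (h mC) => ->.
by rewrite sube0.
Qed.

Section AboveEdge.
Variable z : R.
Hypothesis bz : edge mu < z.

Lemma above_edge_gt0 : 0 < z. Proof. exact: le_lt_trans edge_ge0 bz. Qed.

Lemma above_edge_sqr : s < z ^+ 2.
Proof. by rewrite ltr_pXn2r// nnegrE ?edge_ge0// ltW// above_edge_gt0. Qed.

Let f (x : measurableTypeR R) : R := z / (z ^+ 2 - x).

Lemma kernel_measurable : measurable_fun setT f.
Proof.
pose E : set R := ~` [set z ^+ 2].
have mE : measurable E by apply: measurableC; exact: measurable_set1.
rewrite (_ : setT = E `|` [set z ^+ 2]); last by rewrite setUC setUv.
apply/measurable_funU => //; split; last first.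
  exact: measurable_fun_set1.
apply: open_continuous_measurable_fun.
  exact/closed_openC/closed_eq.
move=> x /set_mem xE.
have xz : z ^+ 2 - x != 0 by rewrite subr_eq0; apply/eqP => e; apply: xE.
suff : (fun y : R => z / (z ^+ 2 - y)) y @[y --> (x : R)] --> z / (z ^+ 2 - x) by [].
apply: cvgM; first exact: cvg_cst.
by apply: cvgV => //; apply: cvgB; [exact: cvg_cst|exact: cvg_id].
Qed.

Lemma kernel_bulk x : D x -> z^-1 <= f x <= z / (z ^+ 2 - s).
Proof.
rewrite /D /= in_itv /= => /andP[x0 xs].
have z0 := above_edge_gt0; have zs := above_edge_sqr.
have zx : x < z ^+ 2 by apply: le_lt_trans zs.
have -> : z^-1 = z / z ^+ 2 by field; rewrite gt_eqF.
rewrite /f !ler_pM2l// lef_pV2 ?posrE ?subr_gt0// ?exprn_gt0//.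
by rewrite lef_pV2 ?posrE ?subr_gt0// lerD2l lerN2 xs gerBl x0.
Qed.

Lemma kernel_integrable : mu.-integrable D (EFin \o f).
Proof.
apply: measurable_bounded_integrable; first exact: measurable_bulk.
- exact: le_lt_trans (probability_le1 mu measurable_bulk) (ltry _).
- by apply: measurable_funS kernel_measurable.
exists (z / (z ^+ 2 - s)); split; first exact: num_real.
move=> y zy x Dx; have /andP[lo hi] := kernel_bulk Dx.
rewrite /= ger0_norm; first by rewrite (le_trans hi)// ltW.
by rewrite (le_trans _ lo)// invr_ge0 ltW// above_edge_gt0.
Qed.

Lemma phi_bulk : phi mu z = Rintegral mu D f.
Proof.
rewrite Rintegral_mkcond; congr fine; apply: ae_eq_integral => //.
- apply/measurable_EFinP. apply: kernel_measurable.
- apply/measurable_EFinP; apply/(measurable_restrictT f measurable_bulk).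
  by apply: (measurable_funS _ _ kernel_measurable).
apply: negligibleS mu_outside_bulk => x /= /not_implyP[_ ne] Dx; apply: ne.
by rewrite patchE mem_set.
Qed.

End AboveEdge.

Lemma integrable_bulk_cst (a : R) : mu.-integrable D (EFin \o (fun=> a)).
Proof.
apply: measurable_bounded_integrable; first exact: measurable_bulk.
- exact: le_lt_trans (probability_le1 mu measurable_bulk) (ltry _).
- exact: measurable_cst.
- by exists `|a|; split; [exact: num_real|move=> y ay x _ /=; exact: ltW].
Qed.

Lemma Rintegral_bulk_cst (a : R) : Rintegral mu D (fun=> a) = a.
Proof.
have h : fine (mu D) = 1 by have := congr1 fine mu_bulk.
rewrite Rintegral_cst; last exact: measurable_bulk.
by rewrite h mulr1.
Qed.

Lemma le_Rintegral_bulk (g : R -> R) a b : mu.-integrable D (EFin \o g) ->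
  (forall x, 0 <= x -> x <= s -> a <= g x <= b) -> a <= Rintegral mu D g <= b.
Proof.
move=> ig gab; rewrite -{1}(Rintegral_bulk_cst a) -(Rintegral_bulk_cst b).
apply/andP; split; apply: le_Rintegral => //; try exact: integrable_bulk_cst.
all: try exact: measurable_bulk.
all: by move=> x; rewrite /D /= in_itv /= => /andP[x0 xs]; have /andP[] := gab x x0 xs.
Qed.

Lemma phi_bounds z : edge mu < z -> z^-1 <= phi mu z <= z / (z ^+ 2 - s).
Proof.
move=> bz; rewrite phi_bulk; apply: le_Rintegral_bulk; first exact: kernel_integrable.
by move=> x x0 xs; apply: kernel_bulk => //; rewrite /D /= in_itv /= x0 xs.
Qed.

Lemma phi_gt0 z : edge mu < z -> 0 < phi mu z.
Proof.
move=> bz; have /andP[h _] := phi_bounds bz; apply: lt_le_trans h.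
by rewrite invr_gt0 (above_edge_gt0 bz).
Qed.

(** For 0 <= x <= edge^2 the integrand increment is
    (v - u) (u v + x) / ((u^2 - x) (v^2 - x)), monotone in x: its value at x = 0
    gives strict monotonicity of phi, its value at the edge a Lipschitz bound. *)
Lemma phi_increment u v : edge mu < u -> u <= v ->
  u^-1 - v^-1 <= phi mu u - phi mu v <=
    (v - u) * ((u * v + s) / ((u ^+ 2 - s) * (v ^+ 2 - s))).
Proof.
move=> bu uv; have bv := lt_le_trans bu uv.
rewrite !phi_bulk -RintegralB; last 3 first.
- exact: measurable_bulk.
- exact: kernel_integrable.
- exact: kernel_integrable.
apply: le_Rintegral_bulk.
  pose fu (x : measurableTypeR R) : R := u / (u ^+ 2 - x).
  pose fv (x : measurableTypeR R) : R := v / (v ^+ 2 - x).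
  rewrite -[X in EFin \o X]/(fun x => fu x - fv x).
  rewrite (_ : EFin \o _ = ((EFin \o fu) \- (EFin \o fv))%E).
  by apply: integrableB; [exact: measurable_bulk|exact: kernel_integrable..].
  by apply/funext => x /=; rewrite EFinB.
move=> x x0 xs.
have u0 := above_edge_gt0 bu; have v0 := above_edge_gt0 bv.
have us := above_edge_sqr bu; have vs := above_edge_sqr bv.
have ux : 0 < u ^+ 2 - x by rewrite subr_gt0 (le_lt_trans xs).
have vx : 0 < v ^+ 2 - x by rewrite subr_gt0 (le_lt_trans xs).
have us' : 0 < u ^+ 2 - s by rewrite subr_gt0.
have vs' : 0 < v ^+ 2 - s by rewrite subr_gt0.
have -> : u / (u ^+ 2 - x) - v / (v ^+ 2 - x) =
    (v - u) * ((u * v + x) / ((u ^+ 2 - x) * (v ^+ 2 - x))).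
  by field; rewrite ?gt_eqF.
have -> : u^-1 - v^-1 = (v - u) * ((u * v) / (u ^+ 2 * v ^+ 2)).
  by field; rewrite ?gt_eqF.
have uv0 : 0 <= v - u by rewrite subr_ge0.
have uv1 : 0 <= u * v by rewrite mulr_ge0 ?ltW.
have u2 : u ^+ 2 - x <= u ^+ 2 by rewrite gerBl.
have v2 : v ^+ 2 - x <= v ^+ 2 by rewrite gerBl.
apply/andP; split; apply: ler_wpM2l => //; apply: ler_pM => //.
- by rewrite invr_ge0 mulr_ge0 ?sqr_ge0.
- by rewrite lerDl.
- rewrite lef_pV2 ?posrE ?mulr_gt0 ?exprn_gt0//; apply: ler_pM => //; exact: ltW.
- by rewrite addr_ge0.
- by rewrite invr_ge0 mulr_ge0// ltW.
- by rewrite lerD2l.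
- rewrite lef_pV2 ?posrE ?mulr_gt0 ?exprn_gt0//; apply: ler_pM;
    [exact: ltW|exact: ltW|by rewrite lerD2l lerN2..].
Qed.

Lemma phi_anti u v : edge mu < u -> u < v -> phi mu v < phi mu u.
Proof.
move=> bu uv; have /andP[h _] := phi_increment bu (ltW uv).
rewrite -subr_gt0; apply: lt_le_trans h; rewrite subr_gt0.
have u0 := above_edge_gt0 bu.
by rewrite ltf_pV2 ?posrE// (lt_trans u0).
Qed.

Lemma phi_continuous u : edge mu < u -> phi mu x @[x --> u] --> phi mu u.
Proof.
move=> bu; pose a := (edge mu + u) / 2.
have ba : edge mu < a by rewrite /a; lra.
have au : a < u by rewrite /a; lra.
pose K := ((u + 1) * (u + 1) + s) / ((a ^+ 2 - s) * (a ^+ 2 - s)).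
have a0 := above_edge_gt0 ba.
have as' : 0 < a ^+ 2 - s by rewrite subr_gt0 (above_edge_sqr ba).
have u0 : 0 < u by exact: lt_trans au.
have K0 : 0 < K.
  rewrite /K divr_gt0 ?mulr_gt0// ltr_wpDr ?sqr_ge0// mulr_gt0//; lra.
have lip x y : a <= x -> x <= y -> y <= u + 1 -> `|phi mu x - phi mu y| <= K * (y - x).
  move=> ax xy yu; have bx := lt_le_trans ba ax.
  have /andP[lo hi] := phi_increment bx xy.
  have x0 := above_edge_gt0 bx; have y0 : 0 < y by exact: lt_le_trans xy.
  have : 0 <= x^-1 - y^-1 by rewrite subr_ge0 lef_pV2 ?posrE.
  move/le_trans/(_ lo) => d0; rewrite ger0_norm//; apply: (le_trans hi).
  rewrite mulrC ler_wpM2r ?subr_ge0// /K.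
  have ax2 : a ^+ 2 - s <= x ^+ 2 - s.
    by rewrite lerD2r ler_pXn2r ?nnegrE ?(ltW a0) ?(ltW x0).
  have ay2 : a ^+ 2 - s <= y ^+ 2 - s.
    by rewrite lerD2r ler_pXn2r ?nnegrE ?(ltW a0) ?(ltW y0)// (le_trans ax).
  have px := lt_le_trans as' ax2; have py := lt_le_trans as' ay2.
  apply: ler_pM.
  - by rewrite addr_ge0 ?sqr_ge0 ?mulr_ge0 ?ltW.
  - by rewrite invr_ge0 mulr_ge0 ?ltW.
  - rewrite lerD2r; apply: ler_pM => //; [exact: ltW|exact: ltW|exact: le_trans xy yu].
  - by rewrite lef_pV2 ?posrE ?mulr_gt0//; apply: ler_pM => //; exact: ltW.
apply/cvgrPdist_lt => e e0; near=> x.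
have ux : `|u - x| < e / K 
  by near: x; apply: cvgr_dist_lt; [exact: cvg_id|exact: divr_gt0].
have x1 : a <= x by apply: ltW; near: x; exact: lt_nbhsr.
have x2 : x <= u + 1 by apply: ltW; near: x; apply: lt_nbhsl; rewrite ltrDl.
have u1 : u <= u + 1 by rewrite lerDl.
have h : K * `|u - x| < e by rewrite mulrC -ltr_pdivlMr.
apply: le_lt_trans h.
have [xu|xu] := lerP x u.
  by rewrite distrC; exact: lip.
by apply: lip => //; exact: ltW.
Unshelve. all: by end_near. Qed.

Section Determinant.
Variable c : R.
Hypothesis hc : 0 < c <= 1.

Lemma phit_gt0 z : edge mu < z -> 0 < phit mu c z.
Proof.
move=> bz; rewrite /phit; have [c0 c1] := andP hc.
rewrite ltr_wpDr ?mulr_gt0 ?phi_gt0// divr_ge0 ?subr_ge0// ltW//.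
exact: above_edge_gt0 bz.
Qed.

Lemma dtr_gt0 z : edge mu < z -> 0 < dtr mu c z.
Proof. by move=> bz; rewrite mulr_gt0 ?phi_gt0 ?phit_gt0. Qed.

Lemma dtr_anti u v : edge mu < u -> u < v -> dtr mu c v < dtr mu c u.
Proof.
move=> bu uv; have bv := lt_trans bu uv; have [c0 c1] := andP hc.
rewrite /dtr; apply: ltr_pM.
- by rewrite ltW// phi_gt0.
- by rewrite ltW// phit_gt0.
- exact: phi_anti.
rewrite /phit ltr_leD ?ltr_pM2l ?phi_anti// ler_wpM2l ?subr_ge0//.
have u0 := above_edge_gt0 bu.
by rewrite lef_pV2 ?posrE ?ltW// (lt_trans u0).
Qed.

Lemma dtr_continuous u : edge mu < u -> dtr mu c x @[x --> u] --> dtr mu c u.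
Proof.
move=> bu; have h := phi_continuous bu.
apply: cvgM => //; apply: cvgD; first by apply: cvgM => //; exact: cvg_cst.
apply: cvgM; first exact: cvg_cst.
apply: cvgV; last exact: cvg_id.
by rewrite gt_eqF// (above_edge_gt0 bu).
Qed.

Lemma dtr_le z : edge mu < z -> 2 * edge mu <= z -> dtr mu c z <= 4 / z ^+ 2.
Proof.
move=> bz z2; have z0 := above_edge_gt0 bz; have [c0 c1] := andP hc.
have /andP[_ hi] := phi_bounds bz.
have s2 : 2 * s <= z ^+ 2.
  have : (2 * edge mu) ^+ 2 <= z ^+ 2.
    by rewrite ler_pXn2r ?nnegrE ?mulr_ge0 ?edge_ge0// ltW.
  by rewrite exprMn /s; have := sqr_ge0 (edge mu); lra.
have ph : phi mu z <= 2 / z.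
  apply: (le_trans hi); rewrite ler_pdivrMr ?subr_gt0 ?(above_edge_sqr bz)//.
  rewrite mulrAC ler_pdivlMr//; rewrite -expr2; lra.
have pt : phit mu c z <= 2 / z.
  rewrite /phit; have : c * phi mu z <= c * (2 / z) by rewrite ler_pM2l.
  have : 0 <= (1 - c) * z^-1 by rewrite mulr_ge0 ?subr_ge0 ?invr_ge0// ltW.
  lra.
have -> : 4 / z ^+ 2 = (2 / z) * (2 / z) by field; rewrite gt_eqF.
by apply: ler_pM => //; apply: ltW; [exact: phi_gt0|exact: phit_gt0].
Qed.

(** By dtr_le the transform falls below any level, so the intermediate value
    theorem on [z, Z] applies as soon as Z exceeds 2 v and twice the edge. *)
Lemma dtr_level z v : edge mu < z -> 0 < v -> v ^- 2 < dtr mu c z ->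
  exists2 z', z < z' & dtr mu c z' = v ^- 2.
Proof.
move=> bz v0 hv; have b0 := edge_ge0.
(* dtr Z <= 4 / Z^2 < v^-2. *)
pose Z := z + 2 * edge mu + 2 * v.
have z0 := above_edge_gt0 bz.
have zZ : z <= Z by rewrite /Z; lra.
have bZ := lt_le_trans bz zZ.
have dZ : dtr mu c Z < v ^- 2.
  have Z2 : 2 * edge mu <= Z by rewrite /Z; lra.
  apply: (le_lt_trans (dtr_le bZ Z2)).
  have : (2 * v) ^+ 2 < Z ^+ 2 by rewrite ltr_pXn2r ?nnegrE// /Z; lra.
  rewrite exprMn => h; rewrite ltr_pdivrMr ?exprn_gt0 ?(lt_le_trans z0)//.
  rewrite mulrC ltr_pdivlMr ?exprn_gt0//; lra.
have [||x] := @IVT R (dtr mu c) z Z (v ^- 2) zZ.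
- apply: continuous_in_subspaceT => x /set_mem /=; rewrite in_itv /= => /andP[zx _].
  exact/dtr_continuous/(lt_le_trans bz).
- by rewrite ge_min le_max (ltW dZ) (ltW hv) orbT.
rewrite in_itv /= => /andP[zx _] ex; exists x => //.
by rewrite lt_neqAle zx andbT; apply/eqP => e; move: hv; rewrite e ex ltxx.
Qed.

Hypothesis hedge : edge_condition mu c.

Lemma dtr_lt_dedge z : edge mu < z -> dtr mu c z < dedge mu c.
Proof.
move=> bz; have [cv _] := hedge; pose y := (edge mu + z) / 2.
have by' : edge mu < y by rewrite /y; lra.
have yz : y < z by rewrite /y; lra.
apply: (lt_le_trans (dtr_anti by' yz)); apply: limr_ge => //.
near=> x; apply: ltW; apply: dtr_anti.
  by near: x; exact: nbhs_right_gt.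
by near: x; exact: nbhs_right_lt.
Unshelve. all: by end_near. Qed.

Lemma spike_loc_gt0 z : edge mu < z -> 0 < spike_loc mu c z.
Proof. by move=> bz; rewrite invr_gt0 sqrtr_gt0 dtr_gt0. Qed.

Lemma spike_locV z : edge mu < z -> spike_loc mu c z ^- 2 = dtr mu c z.
Proof.
by move=> bz; rewrite /spike_loc exprVn invrK sqr_sqrtr// ltW// dtr_gt0.
Qed.

(** A spike above the critical strength at z is supercritical, so its outlier
    location solves dtr = v^-2; dtr being decreasing, that solution exceeds z. *)
Lemma rho_gt z v : edge mu < z -> 0 < v -> spike_loc mu c z < v -> z < rho mu c v.
Proof.
move=> bz v0 hv; have t0 := spike_loc_gt0 bz.
have dv : v ^- 2 < dtr mu c z.
  rewrite -(spike_locV bz) ltf_pV2 ?posrE ?exprn_gt0//.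
  by rewrite ltr_pXn2r// nnegrE ltW.
have tv : theta_star mu c < v.
  apply: lt_trans hv; rewrite /theta_star /spike_loc.
  have d0 := dtr_gt0 bz; have dl := dtr_lt_dedge bz.
  have dd := lt_trans d0 dl.
  by rewrite ltf_pV2 ?posrE ?sqrtr_gt0// ltr_sqrt.
rewrite /rho tv; have [z' zz' ez'] := dtr_level bz v0 dv.
case: xgetP => [y _ [by' ey]|/(_ z')]; last by case; split=> //; exact: lt_trans zz'.
rewrite ltNge; apply/negP; rewrite le_eqVlt => /orP[/eqP yz|yz].
  by move: dv; rewrite -ey yz ltxx.
by have := lt_trans dv (dtr_anti by' yz); rewrite ey ltxx.
Qed.

(** Either the location is the edge, or it solves dtr = v^-2 > dtr z. *)
Lemma rho_lt z v : edge mu < z -> 0 < v -> v < spike_loc mu c z -> rho mu c v < z.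
Proof.
move=> bz v0 hv; rewrite /rho; case: ifP => // _.
case: xgetP => [y _ [by' ey]|//].
have dv : dtr mu c z < v ^- 2.
  have t0 := spike_loc_gt0 bz.
  rewrite -(spike_locV bz) ltf_pV2 ?posrE ?exprn_gt0//.
  by rewrite ltr_pXn2r// nnegrE ltW.
rewrite ltNge; apply/negP; rewrite le_eqVlt => /orP[/eqP yz|yz].
  by move: dv; rewrite -ey yz ltxx.
by have := lt_trans (dtr_anti bz yz) dv; rewrite ey ltxx.
Qed.

End Determinant.
End Transforms.

(** * Events of probability tending to one *)

Section Whp.
Variables (R : realType) (d : nat -> measure_display)
    (T : forall n, measurableType (d n)) (Pr : forall n, probability (T n) R).

Lemma whpT : whp Pr (fun n => setT).
Proof.
exists (fun n => setT); split=> //.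
by apply: cvg_near_cst; apply: nearW => n; exact: probability_setT.
Qed.

Lemma whpS (A B : forall n, set (T n)) :
  (forall n, A n `<=` B n) -> whp Pr A -> whp Pr B.
Proof. by move=> AB [E [mE EA cE]]; exists E; split=> // n; apply: subset_trans (AB n). Qed.

(** P(E) - P(not F) <= P(E and F) <= 1. *)
Lemma whpI (A B : forall n, set (T n)) :
  whp Pr A -> whp Pr B -> whp Pr (fun n => A n `&` B n).
Proof.
move=> [E [mE EA cE]] [F [mF FB cF]]; exists (fun n => E n `&` F n); split.
- by move=> n; exact: measurableI.
- by move=> n; exact: setISS.
apply: (@squeeze_cvge _ _ _ _ (fun n => Pr n (E n) - (1 - Pr n (F n)))%E _ (cst 1%E)).
- apply: nearW => n; apply/andP; split; last first.
    by apply: probability_le1; exact: measurableI.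
  have mI : measurable (E n `&` F n) by exact: measurableI.
  have mC : measurable (~` F n) by exact: measurableC.
  rewrite -probability_setC// leeBlDr ?fin_num_measure//.
  apply: le_trans (measureU2 (Pr n) mI mC).
  apply: le_measure; rewrite ?inE//; first exact: measurableU.
  by move=> x Ex; have [Fx|Fx] := pselect (F n x); [left|right].
- have : (fun n => Pr n (E n) - (1 - Pr n (F n)))%E @ \oo --> (1 - (1 - 1))%E.
    by apply: cvgeB => //; apply: cvgeB => //; exact: cvg_cst.
  by rewrite -!EFinB subrr subr0.
- exact: cvg_cst.
Qed.

Lemma whp_forall (I : finType) (A : I -> forall n, set (T n)) :
  (forall i, whp Pr (A i)) -> whp Pr (fun n => [set w | forall i, A i n w]).
Proof.
move=> hA; suff whp_in (l : seq I) :
    whp Pr (fun n => [set w | forall i, i \in l -> A i n w]).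
  by apply: whpS (whp_in (enum I)) => n w h i; apply: h; rewrite mem_enum.
elim: l => [|i l IHl]; first by apply: whpS whpT => n w _ i.
apply: whpS (whpI (hA i) IHl) => n w [Ai Al] j.
by rewrite inE => /orP[/eqP->|/Al].
Qed.

End Whp.

(** * From half-lines to unions of intervals *)

Section Balance.
Variables (R : realType) (n r : nat) (a : 'I_n -> R) (b : 'I_r -> R) (E : set R).
Hypotheses (a_avoids : forall j, ~ E (a j)) (b_avoids : forall i, ~ E (b i))
  (count_above : forall e, E e ->
    #|[set j | e < a j]%SET| = #|[set i | e < b i]%SET|).

Definition step (e x : R) : int := (e < x)%R%:R.

(** Equality of the two sums alone is not stable under products, which unions
    produce; weighting by the half-lines starting in E makes it so. *)
Definition balanced (f : R -> int) : Prop :=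
  \sum_j f (a j) = \sum_i f (b i) /\
  forall e, E e -> \sum_j f (a j) * step e (a j) = \sum_i f (b i) * step e (b i).

Lemma stepM e e' x : step e x * step e' x = step (Num.max e e') x.
Proof. by rewrite /step gt_max -natrM mulnb. Qed.

Lemma sum_step e : E e -> \sum_j step e (a j) = \sum_i step e (b i).
Proof.
move=> /count_above; rewrite -!sum1_card => /(congr1 (fun k => k%:R : int)).
rewrite !natr_sum big_mkcond /= [in RHS]big_mkcond /= => h.
apply: etrans (etrans h _); apply: eq_bigr => i _; rewrite inE /step; by case: ifP.
Qed.

Lemma balanced_mul_step f e : E e -> balanced f -> balanced (fun x => f x * step e x).
Proof.
move=> Ee [_ fE]; split; first exact: fE.
move=> e' Ee'.
have Em : E (Num.max e e') by rewrite maxEle; case: ifP.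
have h := fE _ Em.
by apply: etrans (etrans h _); apply: eq_bigr => i _; rewrite /= -stepM mulrA.
Qed.

Lemma balanced_step e : E e -> balanced (step e).
Proof.
move=> Ee; split; first exact: sum_step.
move=> e' Ee'; have Em : E (Num.max e e') by rewrite maxEle; case: ifP.
under [LHS]eq_bigr do rewrite stepM.
by under [RHS]eq_bigr do rewrite stepM; exact: sum_step.
Qed.

Lemma balancedD f g : balanced f -> balanced g -> balanced (fun x => f x + g x).
Proof.
move=> [f1 fE] [g1 gE]; split; first by rewrite !big_split f1 g1.
move=> e Ee; under [LHS]eq_bigr do rewrite mulrDl.
by under [RHS]eq_bigr do rewrite mulrDl; rewrite !big_split /= fE// gE.
Qed.

Lemma balancedB f g : balanced f -> balanced g -> balanced (fun x => f x - g x).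
Proof.
move=> [f1 fE] [g1 gE]; split; first by rewrite !sumrB f1 g1.
move=> e Ee; under [LHS]eq_bigr do rewrite mulrBl.
by under [RHS]eq_bigr do rewrite mulrBl; rewrite !sumrB fE// gE.
Qed.

Lemma eq_balanced f g : (forall x, ~ E x -> f x = g x) -> balanced f -> balanced g.
Proof.
move=> fg [f1 fE]; split.
  apply: etrans (etrans f1 _); apply: eq_bigr => i _; last exact: fg.
  by apply/esym/fg.
move=> e Ee; apply: etrans (etrans (fE e Ee) _); apply: eq_bigr => i _; last by rewrite fg.
by rewrite fg.
Qed.

(** Off its endpoints an interval has indicator step lo - step hi, and
    1_(A U I) = 1_A + 1_I - 1_A 1_I. *)
Lemma balanced_has (K : Type) (J : K -> pred R) (lo hi : K -> R) (s : seq K) :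
  (forall q, E (lo q)) -> (forall q, E (hi q)) -> (forall q, lo q <= hi q) ->
  (forall q x, ~ E x -> J q x = (lo q < x) && (x < hi q)) ->
  balanced (fun x => (has (J ^~ x) s)%:R).
Proof.
move=> Elo Ehi lohi JE; elim: s => [|q s IHs] /=.
  by split=> [|e Ee]; rewrite !big1// => i _; rewrite mul0r.
pose f x : int := (has (J ^~ x) s)%:R.
have J_step x : ~ E x -> (J q x)%:R = step (lo q) x - step (hi q) x :> int.
  move=> nE; rewrite (JE q x nE) /step; have lh := lohi q.
  have ne : x != hi q by apply/eqP => xh; apply: nE; rewrite xh.
  case: (ltrgtP x (hi q)) ne => //= [xh|xh] _; rewrite ?andbT ?andbF.
    by rewrite subr0.
  by rewrite (le_lt_trans lh xh) subrr.
apply: (@eq_balanced (fun x => (step (lo q) x - step (hi q) x) + f x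
    - (f x * step (lo q) x - f x * step (hi q) x))).
  move=> x nE; rewrite -mulrBr -J_step// /f.
  by case: (J q x); case: (has _ s); rewrite //= ?mulr1 ?mulr0 ?mul0r ?subr0 ?addr0 ?addrK ?add0r.
apply: balancedB.
  by apply: balancedD => //; apply: balancedB; exact: balanced_step.
by apply: balancedB; apply: balanced_mul_step.
Qed.

Lemma card_union_intervals k (lo hi : 'I_k -> R) (lcl rcl : 'I_k -> bool)
    (B := \bigcup_(q in [set: 'I_k])
       [set` Interval (BSide (lcl q) (lo q)) (BSide (rcl q) (hi q))]) :
  (forall q, E (lo q)) -> (forall q, E (hi q)) -> (forall q, lo q <= hi q) ->
  #|[set j | a j \in B]%SET| = #|[set i | b i \in B]%SET|.
Proof.
move=> Elo Ehi lohi.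
pose J q x := x \in Interval (BSide (lcl q) (lo q)) (BSide (rcl q) (hi q)).
have BE x : (x \in B) = has (J ^~ x) (enum 'I_k).
  apply/idP/hasP => [/set_mem [q _ Jx]|[q _ Jx]]; last by apply/mem_set; exists q.
  by exists q; rewrite ?mem_enum.
have JE q x : ~ E x -> J q x = (lo q < x) && (x < hi q).
  move=> nE.
  have xl : lo q != x by apply/eqP => h; apply: nE; rewrite -h.
  have xh : x != hi q by apply/eqP => h; apply: nE; rewrite h.
  by rewrite /J in_itv /=; case: (lcl q); case: (rcl q); rewrite /= ?lt_neqAle ?xl ?xh.
have [h _] := balanced_has (enum 'I_k) Elo Ehi lohi JE.
apply/eqP; rewrite -!sum1_card -(@eqr_nat int) !natr_sum.
rewrite big_mkcond [X in _ == X]big_mkcond; apply/eqP.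
apply: etrans (etrans h _); apply: eq_bigr => i _; rewrite inE BE; by case: has.
Qed.

End Balance.

(** * The random count and its consequences *)

(** Three events: X has norm below z, the weighted error at z is smaller than a
    constant e depending on z and gam only, and the spikes avoid the critical
    strength. *)
Lemma whp_spike_count (R : realType) (m : nat -> nat) (c : R) (hc : 0 < c <= 1)
  (d : nat -> measure_display) (T : forall n, measurableType (d n))
  (Pr : forall n, probability (T n) R)
  (X : forall n, T n -> 'M[R[i]]_(n, m n)) (r : forall n, T n -> nat)
  (U : forall n (w : T n), 'M[R[i]]_(n, r n w))
  (V : forall n (w : T n), 'M[R[i]]_(m n, r n w))
  (theta : forall n (w : T n), 'I_(r n w) -> R)
  (theta0 : forall n w i, 0 < theta n w i)
  (mu : probability (measurableTypeR R) R) (hglobal : global_noise_law Pr X mu)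
  (z : R) :
  edge mu < z -> weighted_compat Pr X U V theta mu c z ->
  spikes_avoid Pr theta (spike_loc mu c z) ->
  whp Pr (fun n => [set w |
    let W := X n w + U n w *m theta_mx (theta n w) *m (V n w)^t* in
    [/\ #|[set j : 'I_n | z < singular_value W j]%SET| =
          #|[set i | spike_loc mu c z < theta n w i]%SET|,
        forall j : 'I_n, singular_value W j != z
      & forall i, theta n w i != spike_loc mu c z]]).
Proof.
move=> bz [al [be [_ alz zbe small]]] [gam gam0 gap].
have [mu_pos mu_supp _ opX] := hglobal.
have f0 : 0 < phi mu z by exact: phi_gt0.
have g0 : 0 < phit mu c z by exact: phit_gt0.
have fg0 : 0 < dtr mu c z by exact: dtr_gt0.
have s0 : 0 < Num.sqrt (dtr mu c z) by rewrite sqrtr_gt0.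
pose K := 2 * (phi mu z + phit mu c z).
have K0 : 0 < K by rewrite mulr_gt0// addr_gt0.
(* Both diagonal parts of the model, 2 d |t - theta| >= 2 d gam and
   2 d (t + theta) > 2 sqrt d, must dominate the error,
   which is below e K. *)
pose e := Num.min (2 * dtr mu c z * gam) (2 * Num.sqrt (dtr mu c z)) / K.
have e0 : 0 < e by rewrite divr_gt0// lt_min !mulr_gt0.
have eK1 x : x < e -> x * K < 2 * dtr mu c z * gam.
  by rewrite ltr_pdivlMr// lt_min => /andP[].
have eK2 x : x < e -> x * K < 2 * Num.sqrt (dtr mu c z).
  by rewrite ltr_pdivlMr// lt_min => /andP[].
have zb0 : 0 < z - edge mu by rewrite subr_gt0.
have := whpI (whpI (opX _ zb0) (small _ e0)) gap.
apply: whpS => n w [] [] oX err gapw /=.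
move: oX err gapw => /= oX err gapw.
have Xz : opnorm (X n w) < z.
  by move: oX; rewrite lte_fin ltr_norml => /andP[_]; rewrite ltrD2r.
have errz : (weighted_error mu c (X n w) (U n w) (V n w) (theta n w) z < e%:E)%E.
  move: err; rewrite sube0 => /(le_lt_trans (lee_abs _)); apply: le_lt_trans.
  by apply: ereal_sup_ubound; exists z => //=; rewrite in_itv /= !ltW.
move: errz; rewrite /weighted_error; case: ifPn => [uA|_]; last by rewrite ltNge leey.
rewrite lte_fin => errz.
have {errz} errK := le_lt_trans (ler_wpDl (opnorm_ge0 _) (lexx _)) errz.
have := spike_count (above_edge_gt0 bz) f0 g0 Xz uA (theta0 n w) gapw
  (eK1 _ errK) (eK2 _ errK).
move=> /= [cnt ne]; split; [by apply: cnt|by apply: ne|] => i; apply/eqP => ti.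
by have := gapw i; rewrite ti subrr normr0 leNgt gam0.
Qed.

Theorem corollary3p4 (R : realType) (F : base_field)
  (m : nat -> nat) (c : R)
  (hm : forall n, (n <= m n)%N)
  (hc : 0 < c <= 1)
  (hmc : (n%:R / (m n)%:R : R) @[n --> \oo] --> c)
  (d : nat -> measure_display) (T : forall n, measurableType (d n))
  (Pr : forall n, probability (T n) R)
  (X P : forall n, T n -> 'M[R[i]]_(n, m n))
  (hXF : forall n w, X n w \is a mxOver (scalars F))
  (hX : forall n, random_mx (X n))
  (hP : forall n, random_mx (P n))
  (r : forall n, T n -> nat)
  (hr : forall n w, \rank (P n w) = r n w)
  (U : forall n (w : T n), 'M[R[i]]_(n, r n w))
  (V : forall n (w : T n), 'M[R[i]]_(m n, r n w))
  (theta : forall n (w : T n), 'I_(r n w) -> R)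
  (hU : forall n w, stiefel F (U n w))
  (hV : forall n w, stiefel F (V n w))
  (htheta0 : forall n w i, 0 < theta n w i)
  (htheta : forall n w (i j : 'I_(r n w)), (i <= j)%N ->
     theta n w j <= theta n w i)
  (hPUV : forall n w, P n w = U n w *m theta_mx (theta n w) *m (V n w)^t*)
  (mu : probability (measurableTypeR R) R)
  (hglobal : global_noise_law Pr X mu)
  (hedge : edge_condition mu c)
  (hlocal : local_law Pr X U V mu c) :
  (forall z0 : R, edge mu < z0 ->
     weighted_compat Pr X U V theta mu c z0 ->
     spikes_avoid Pr theta (spike_loc mu c z0) ->
     whp Pr (fun n => [set w |
       #|[set j : 'I_n | z0 < singular_value (X n w + P n w) j]%SET| =
       #|[set i : 'I_(r n w) | spike_loc mu c z0 < theta n w i]%SET| ]))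
  /\
  (forall (k : nat) (lo hi : 'I_k -> R) (lcl rcl : 'I_k -> bool),
     (forall q, lo q <= hi q) ->
     (forall q z, z = lo q \/ z = hi q ->
        [/\ edge mu < z,
            weighted_compat Pr X U V theta mu c z
          & spikes_avoid Pr theta (spike_loc mu c z)]) ->
     let B : set R := \bigcup_(q in [set: 'I_k])
       [set` Interval (BSide (lcl q) (lo q)) (BSide (rcl q) (hi q))] in
     whp Pr (fun n => [set w |
       #|[set j : 'I_n | singular_value (X n w + P n w) j \in B]%SET| =
       #|[set i : 'I_(r n w) | rho mu c (theta n w i) \in B]%SET| ])).
Proof.
have count := whp_spike_count (U := U) (V := V) hc htheta0 hglobal.
split=> [z bz comp avoid|k lo hi lcl rcl lohi ends B].
  apply: (whpS _ (count z bz comp avoid)) => n w /=; rewrite -hPUV.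
  by case.
have [mu_pos mu_supp _ _] := hglobal.
pose endpoint (q : 'I_k * bool) := if q.2 then lo q.1 else hi q.1.
have good q : [/\ edge mu < endpoint q,
    weighted_compat Pr X U V theta mu c (endpoint q)
    & spikes_avoid Pr theta (spike_loc mu c (endpoint q))].
  by apply: (ends q.1); rewrite /endpoint; case: q.2; [left|right].
have countE q := let: And3 bz comp avoid := good q in count _ bz comp avoid.
have := whp_forall countE.
apply: whpS => n w /= cnt.
pose E := range endpoint.
apply: (@card_union_intervals R _ _ (fun j : 'I_n => singular_value (X n w + P n w) j)
  (fun i => rho mu c (theta n w i)) E).
- move=> j [q _ eq]; have [_ ne _] := cnt q; move: (ne j).
  by rewrite -hPUV eq eqxx.
- move=> i [q _ eq]; have [_ _ /(_ i) ne] := cnt q; have [bz _ _] := good q.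
  move: eq; have [lt|lt|/eqP] := ltgtP (theta n w i) (spike_loc mu c (endpoint q)).
  + by move/esym/eqP; rewrite lt_eqF// (rho_lt mu_pos).
  + by move/esym/eqP; rewrite gt_eqF// (rho_gt mu_pos).
  by rewrite (negPf ne).
- move=> _ [q _ <-]; have [ce _ ne] := cnt q; have [bz _ _] := good q.
  rewrite -hPUV in ce; rewrite ce; apply: eq_card => i; rewrite !inE.
  have := ne i; case: ltgtP => // lt _; apply/esym.
    by rewrite (rho_gt mu_pos).
  by apply/negbTE; rewrite -leNgt ltW// (rho_lt mu_pos).
- by move=> q; exists (q, true).
- by move=> q; exists (q, false).
- exact: lohi.
Qed.
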